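(* Let $N\ge1$, $n\ge0$, $z_1,\dots,z_n\in\mathbb{C}$, and let $\lambda$ be a partition. Then, for $h_1=\cdots=h_N=0$ (i.e. with $h=0$), $$T_\lambda(u)\big|_{h_1=\cdots=h_N=0}=\beta_\lambda(u)\quad\text{in }\operatorname{End}((\mathbb{C}^N)^{\otimes n}).$$
   Context: $[n]=\{1,\dots,n\}$; $E_{i,j}\in\operatorname{End}(\mathbb{C}^N)$ denotes the matrix unit, and $A^{(k)}$ denotes $A\in\operatorname{End}(\mathbb{C}^N)$ acting in the $k$th tensor factor of $(\mathbb{C}^N)^{\otimes n}$. The group algebra $\mathbb{C}[\mathfrak{S}_n]$ acts on $(\mathbb{C}^N)^{\otimes n}$ by permuting tensor factors, $\sigma(v_1\otimes\cdots\otimes v_n)=v_{\sigma^{-1}(1)}\otimes\cdots\otimes v_{\sigma^{-1}(n)}$; for $K\subseteq[n]$, $\mathfrak{S}_K\subseteq\mathfrak{S}_n$ is the group of permutations of $K$. Operators $T_\lambda$. For $h\in\operatorname{End}(\mathbb{C}^N)$, $s_\lambda(h)$ denotes the Schur polynomial $s_\lambda(x_1,\dots,x_N)$ evaluated at the eigenvalues $h_1,\dots,h_N$ of $h$ (it is $0$ if $\lambda$ has more than $N$ nonzero parts). For a polynomial function $f$ on $\operatorname{End}(\mathbb{C}^N)$ and $K\subseteq[n]$, define $$\mathsf{d}_Kf(h)=\sum_{(i_k,j_k)_{k\in K}\in([N]^2)^K}\Big(\prod_{k\in K}\partial_{\varepsilon_k}\Big)\Big|_{\varepsilon=0}f\Big(h+\sum_{k\in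 K}\varepsilon_kE_{j_k,i_k}\Big)\cdot\prod_{k\in K}E_{i_k,j_k}^{(k)},$$ with $\mathsf{d}_\varnothing f(h)=f(h)\cdot\mathrm{Id}$. Then $$T_\lambda(u)=(u+z_1+\mathsf{d}_1)\cdots(u+z_n+\mathsf{d}_n)s_\lambda(h)=\sum_{K\subseteq[n]}\Big(\prod_{k\in[n]\setminus K}(u+z_k)\Big)\mathsf{d}_Ks_\lambda(h)\in\operatorname{End}((\mathbb{C}^N)^{\otimes n})[u].$$ Operators $\beta_\lambda$. For a finite set $K$ and a partition $\lambda$ of $|K|$, let $\alpha_\lambda^{(K)}=\sum_{\sigma\in\mathfrak{S}_K}\chi^\lambda(\sigma)\sigma\in\mathbb{C}[\mathfrak{S}_K]$, where $\chi^\lambda$ is the character of the Specht module (irreducible representation) of $\mathfrak{S}_K$ indexed by $\lambda$ (so $\chi^{(m)}$ is trivial and $\chi^{(1^m)}$ is the sign character). Then $$\beta_\lambda(u)=\sum_{\substack{K\subseteq[n]\\|K|=|\lambda|}}\Big(\prod_{k\in[n]\setminus K}(u+z_k)\Big)\alpha_\lambda^{(K)}\in\mathbb{C}[\mathfrak{S}_n][u],$$ regarded as an element of $\operatorname{End}((\mathbb{C}^N)^{\otimes n})[u]$. *)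

(* Defs.v *)
From HB Require Import structures.
From mathcomp Require Import all_boot all_order all_algebra all_fingroup.
From mathcomp Require Import all_field all_character.
From mathcomp Require Import classical_sets reals topology normedtype derive.
From mathcomp Require Import complex.
Set Implicit Arguments.
Unset Strict Implicit.
Unset Printing Implicit Defensive.
Import Order.TTheory GRing.Theory Num.Theory.
Import numFieldNormedType.Exports.
Local Open Scope ring_scope.

(* Numbering starts at 0: rows and columns of diagrams, the letters of 'I_N
   and the tensor factors in 'I_n. *)

Definition is_part (lam : seq nat) : bool :=
  sorted geq lam && (0%N \notin lam).

Section Schur.

Variables (lam : seq nat) (N : nat).

Definition cell : finType := {i : 'I_(size lam) & 'I_(nth 0%N lam i)}.
Definition cell_row (c : cell) : nat := tag c.
Definition cell_col (c : cell) : nat := tagged c.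

Definition semistandard (t : {ffun cell -> 'I_N}) : bool :=
  [forall c, forall c',
     ((cell_row c == cell_row c') && (cell_col c < cell_col c')%N
        ==> (t c <= t c')%N)
  && ((cell_col c == cell_col c') && (cell_row c < cell_row c')%N
        ==> (t c < t c')%N)].

Definition schur (R : comNzRingType) (x : 'I_N -> R) : R :=
  \sum_(t : {ffun cell -> 'I_N} | semistandard t) \prod_c x (t c).

End Schur.

(* The eigenvalues of h, with multiplicity (the order is irrelevant, Schur
   polynomials being symmetric). *)
Definition eigenvalues (C : numClosedFieldType) (N : nat) (h : 'M[C]_N) :
    seq C :=
  sval (closed_field_poly_normal (char_poly h)).

Definition schur_mx (C : numClosedFieldType) (lam : seq nat) (N : nat)
    (h : 'M[C]_N) : C :=
  schur lam (fun i : 'I_N => (eigenvalues h)`_i).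

Section MixedDerivative.

Variables (C : numClosedFieldType) (I : finType).

Definition partial (k : I) (g : (I -> C) -> C) : (I -> C) -> C :=
  fun e => derive1 (fun t : C => g [eta e with k |-> t] : C^o) (e k).

Definition mixed_partial0 (g : (I -> C) -> C) : C :=
  foldr partial g (enum I) (fun=> 0).

End MixedDerivative.

Section TensorPower.

Variables (N n : nat).

(* The multi-index a stands for the basis vector
   e_(a 0) (x) ... (x) e_(a (n-1)) of the n-th tensor power of C^N. *)
Definition mindex : finType := {ffun 'I_n -> 'I_N}.

(* Operators on the tensor power, as matrices acting on column vectors in the
   basis above; the dimension is N ^ n. Operators depending polynomially on
   the indeterminate u are matrices over {poly C}, with 'X for u. *)
Definition op_of (R : nzRingType) (f : mindex -> mindex -> R) : 'M[R]_#|mindex| :=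
  \matrix_(a, b) f (enum_val a) (enum_val b).

Definition factor_op (R : nzRingType) (k : 'I_n) (A : 'M[R]_N) :
    'M[R]_#|mindex| :=
  op_of (fun a b => A (a k) (b k) *+ [forall l, (l != k) ==> (a l == b l)]).

(* s sends e_(b 0) (x) ... to e_(b (s^-1 0)) (x) ... *)
Definition perm_op (R : nzRingType) (s : 'S_n) : 'M[R]_#|mindex| :=
  op_of (fun a b => ([forall l, a l == b ((s^-1)%g l)])%:R).

End TensorPower.

Section TOperator.

Variables (C : numClosedFieldType) (N n : nat).

Definition dop (K : {set 'I_n}) (f : 'M[C]_N -> C) (h : 'M[C]_N) :
    'M[C]_#|mindex N n| :=
  \sum_(p : {ffun {k : 'I_n | k \in K} -> 'I_N * 'I_N})
     mixed_partial0 (fun e =>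
        f (h + \sum_k e k *: delta_mx (p k).2 (p k).1))
     *: \prod_(k : {k : 'I_n | k \in K})
          factor_op (val k) (delta_mx (p k).1 (p k).2).

Definition T_op (lam : seq nat) (z : 'I_n -> C) (h : 'M[C]_N) :
    'M[{poly C}]_#|mindex N n| :=
  \sum_(K : {set 'I_n})
     (\prod_(k in ~: K) ('X + (z k)%:P))
     *: map_mx polyC (dop K (@schur_mx C lam N) h).

End TOperator.

Section Specht.

Variables (C : fieldType) (n : nat) (lam : seq nat) (K : {set 'I_n}).

(* Positions in the tableau [reshape lam (enum K)], in which the elements of K
   are written in increasing order along the rows of lam. *)
Definition tab_row (k : 'I_n) : nat := reshape_index lam (index k (enum K)).
Definition tab_col (k : 'I_n) : nat := reshape_offset lam (index k (enum K)).

Definition row_stab : {set 'S_n} :=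
  [set s in Sym K | [forall k in K, tab_row (s k) == tab_row k]].
Definition col_stab : {set 'S_n} :=
  [set s in Sym K | [forall k in K, tab_col (s k) == tab_col k]].

(* The product of the signed sum over the column stabiliser by the sum over the
   row stabiliser, in the group algebra of S_K. The library composes
   permutations from left to right, so (p * q)%g applies p first. *)
Definition young_symmetrizer : 'rV[C]_#|Sym K| :=
  \sum_(p in row_stab) \sum_(q in col_stab)
     (-1) ^+ q *: delta_mx 0 (gring_index (Sym K) (p * q)%g).

(* The Specht module as the left ideal generated by the Young symmetrizer: the
   submodule generated by the polytabloid of the tableau, inside the
   permutation module on tabloids identified with the left ideal generated by
   the sum over the row stabiliser. Right multiplication for the library's
   product is left multiplication for the usual one. *)
Definition specht_repr :
    mx_representation C (Sym K)
      (\rank (cyclic_mx (regular_repr C (Sym K)) young_symmetrizer)) :=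
  submod_repr (cyclic_mx_module (regular_repr C (Sym K)) young_symmetrizer).

Definition specht_char (s : 'S_n) : C := \tr (specht_repr s).

End Specht.

Section BetaOperator.

Variables (C : numClosedFieldType) (N n : nat).

Definition alpha_op (lam : seq nat) (K : {set 'I_n}) : 'M[C]_#|mindex N n| :=
  \sum_(s in Sym K) specht_char C lam K s *: perm_op N C s.

Definition beta_op (lam : seq nat) (z : 'I_n -> C) :
    'M[{poly C}]_#|mindex N n| :=
  \sum_(K : {set 'I_n} | #|K| == sumn lam)
     (\prod_(k in ~: K) ('X + (z k)%:P)) *: map_mx polyC (alpha_op lam K).

End BetaOperator.

(* Main.v *)
(* With [m = sumn lam], everything rests on Frobenius' formula: [m! s_lam(h)]
   is the sum over [s] of [chi s] times the trace of [h^(x)m] composed with [s].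
   Applied to [h = sum_k e_k E_{j_k i_k}], the coefficient of the product of the
   [e_k] in that trace is a sum over bijections [f] of the index set, and [f]
   contributes the matrix coefficient of the permutation conjugate to [s] by
   [f]; as [chi] is a class function the [m!] bijections contribute equally.

   For Frobenius' formula, trigonalise [h]: its traces become sums of monomials
   in the eigenvalues over the words fixed by [s], and the claim is Young's rule
   that the invariants of the stabiliser [H] of a word [w] in the Specht module
   have as dimension the number of semistandard rearrangements of [w]. Mapping
   the group algebra onto the span of the rearrangements of [w], these
   invariants become the span of their polytabloids. Two rearrangement
   inequalities finish the count: column descents are straightened by Garnir
   relations, which increase [sum col * v], and the polytabloids of semistandard
   words are triangular with respect to [sum row * v]. *)
Require Import Defs.
From mathcomp Require Import boolp functions topology normedtype derive.
From mathcomp Require Import all_boot all_order all_algebra all_fingroup.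
From mathcomp Require Import all_field all_character.
From mathcomp Require Import reals complex ring.
Set Implicit Arguments.
Unset Strict Implicit.
Unset Printing Implicit Defensive.
Import Order.TTheory GRing.Theory Num.Theory.
Import numFieldNormedType.Exports.
Local Open Scope ring_scope.

(** * Words and weights *)

Section WordAction.

Variables (T : finType) (N : nat).
Local Notation word := {ffun T -> 'I_N}.
Implicit Types (w : word) (s : {perm T}) (om : T -> nat).

Definition wact (w : word) (s : {perm T}) : word := [ffun x => w (s x)].

Lemma wactM w s t : wact (wact w s) t = wact w (t * s)%g.
Proof. by apply/ffunP=> x; rewrite !ffunE permM. Qed.

Lemma wact1 w : wact w 1%g = w.
Proof. by apply/ffunP=> x; rewrite ffunE perm1. Qed.

Lemma wactK s : cancel (wact^~ s) (wact^~ s^-1%g).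
Proof. by move=> w; rewrite wactM mulVg wact1. Qed.

Lemma wact_tperm w x y : w x = w y -> wact w (tperm x y) = w.
Proof. by move=> e; apply/ffunP=> z; rewrite ffunE; case: tpermP => // ->. Qed.

Definition weight (om : T -> nat) (w : word) : int := \sum_x (om x)%:Z * (w x)%:Z.

Lemma weight_stab om w (s : {perm T}) :
  (forall x, om (s x) = om x) -> weight om (wact w s) = weight om w.
Proof.
move=> oms; rewrite /weight [RHS](reindex_inj (@perm_inj _ s)).
by apply: eq_bigr => x _; rewrite ffunE oms.
Qed.

(** The letter at [z] in [wact w s] comes from [s z]: letters above [tau] never lose weight and the
    others never gain any. The differences [d z] sum to zero, so a constant may be subtracted from
    all letters; after subtracting [tau + 1/2] every summand is nonnegative, and the one at [z0] is
    positive. *)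
Lemma weight_rearrange om w (s : {perm T}) (tau : nat) z0 :
    (forall z, (tau < w (s z))%N -> (om (s z) <= om z)%N) ->
    (forall z, (w (s z) <= tau)%N -> (om z <= om (s z))%N) ->
    om (s z0) != om z0 ->
  weight om w < weight om (wact w s).
Proof.
move=> hi lo ne; pose d z : int := (om z)%:Z - (om (s z))%:Z.
have d0 : \sum_z d z = 0.
  by rewrite sumrB (reindex_inj (@perm_inj _ s)) subrr.
have -> : weight om w = \sum_z (om (s z))%:Z * (w (s z))%:Z.
  by rewrite /weight (reindex_inj (@perm_inj _ s)).
have -> : weight om (wact w s) = \sum_z (om z)%:Z * (w (s z))%:Z.
  by apply: eq_bigr => z _; rewrite ffunE.
(* Doubling keeps the shift by [tau + 1/2] inside the integers. *)
rewrite -subr_gt0 -sumrB -(pmulr_rgt0 _ (isT : 0 < 2%:Z)).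
have -> : 2%:Z * \sum_z ((om z)%:Z * (w (s z))%:Z - (om (s z))%:Z * (w (s z))%:Z)
   = \sum_z d z * (2%:Z * (w (s z))%:Z - 2%:Z * tau%:Z - 1).
  transitivity (2%:Z * \sum_z ((om z)%:Z * (w (s z))%:Z - (om (s z))%:Z * (w (s z))%:Z)
     - (\sum_z d z) * (2%:Z * tau%:Z + 1)); first by rewrite d0 mul0r subr0.
  rewrite mulr_sumr mulr_suml -sumrB; apply: eq_bigr => z _.
  by rewrite /d; ring.
have pos z : 0 <= d z * (2%:Z * (w (s z))%:Z - 2%:Z * tau%:Z - 1)
    ?= iff (om (s z) == om z).
  rewrite /d; case: (leqP (w (s z)) tau) => h.
    have le := lo _ h; apply/leifP; case: eqP => [->|/eqP n].
      by rewrite subrr mul0r.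
    rewrite nmulr_rgt0; last by rewrite subr_lt0 ltz_nat ltn_neqAle eq_sym n le.
    by rewrite -mulrBr subr_lt0 (@le_lt_trans _ _ 0) // pmulr_rle0 // subr_le0 lez_nat.
  have le := hi _ h; apply/leifP; case: eqP => [->|/eqP n].
    by rewrite subrr mul0r.
  rewrite pmulr_rgt0; last by rewrite subr_gt0 ltz_nat ltn_neqAle n le.
  rewrite -mulrBr subr_gt0 (@lt_le_trans _ _ (2 * 1)) //.
  by rewrite ler_pM2l // lerBrDl -PoszD lez_nat addn1.
rewrite (bigD1 z0) //=; apply: ltr_wpDr.
  by apply: sumr_ge0 => z _; exact: (pos z).1.
by have /leifP := pos z0; rewrite (negbTE ne).
Qed.

Lemma weight_tperm om w x y :
  (om x < om y)%N -> (w y < w x)%N -> weight om w < weight om (wact w (tperm x y)).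
Proof.
move=> lo lw; apply: (@weight_rearrange _ _ _ (w y) x).
- move=> z; case: tpermP => // [->|->] //; first by rewrite ltnn.
  by move=> _; exact: ltnW.
- move=> z; case: tpermP => // [->|->] //; first by move=> _; exact: ltnW.
  by rewrite leqNgt lw.
- by rewrite tpermL neq_ltn lo orbT.
Qed.

End WordAction.

(** * Polytabloids and Garnir relations *)

Section FibreStabiliser.

Variables (T : finType) (K : {set T}) (f : T -> nat).

(** For [f] the row or the column function of a tableau this unfolds to [row_stab] or [col_stab], so
    facts proved here apply to the Young symmetrizer directly. *)
Definition fibre_stab : {set {perm T}} :=
  [set s in Sym K | [forall k in K, f (s k) == f k]].

Lemma fibre_stabP s :
  reflect (s \in Sym K /\ forall x, f (s x) = f x) (s \in fibre_stab).
Proof.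
rewrite [s \in fibre_stab]in_set; apply: (iffP andP) => -[sK sf]; split=> //.
  move=> x.
  have [xK|xK] := boolP (x \in K); first by move/forall_inP: sf => /(_ x xK)/eqP.
  by congr f; apply: out_perm xK; move: sK; rewrite inE.
by apply/forall_inP=> x _; rewrite sf.
Qed.

Lemma fibre_stab_group_set : group_set fibre_stab.
Proof.
apply/group_setP; split=> [|s t].
  by apply/fibre_stabP; split=> [|x]; rewrite ?group1 ?perm1.
move=> /fibre_stabP[sK sf] /fibre_stabP[tK tf]; apply/fibre_stabP.
by split=> [|x]; rewrite ?groupM // permM tf sf.
Qed.
Canonical fibre_stab_group := Group fibre_stab_group_set.

Lemma Sym_tperm (S : {set T}) x y : x \in S -> y \in S -> tperm x y \in Sym S.
Proof.
move=> xS yS; rewrite inE; apply/subsetP=> z; rewrite inE.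
by case: tpermP => // [->|->|]; rewrite ?eqxx.
Qed.

Lemma fibre_stab_tperm x y :
  x \in K -> y \in K -> f x = f y -> tperm x y \in fibre_stab.
Proof.
move=> xK yK e; apply/fibre_stabP; split; first exact: Sym_tperm.
by move=> z; case: tpermP => // ->.
Qed.

End FibreStabiliser.

Lemma Sym_stable (T : finType) (S : {set T}) (s : {perm T}) x :
  s \in Sym S -> (s x \in S) = (x \in S).
Proof. by rewrite inE => sS; rewrite (perm_closed x sS). Qed.

Lemma Sym_out (T : finType) (S : {set T}) (s : {perm T}) x :
  s \in Sym S -> x \notin S -> s x = x.
Proof. by rewrite inE => sS; apply: out_perm. Qed.

Section Polytabloid.

Variables (F : numFieldType) (T : finType) (N : nat) (K : {set T}).
Variables (row col : T -> nat).
Local Notation word := {ffun T -> 'I_N}.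
Implicit Types (v w : word).
Local Notation R := (fibre_stab K row).
Local Notation C := (fibre_stab K col).

Definition word_vec w : 'rV[F]_#|{: word}| := delta_mx 0 (enum_rank w).

(** The image of the Young symmetrizer under the linear extension of [g |-> wact w g]. Letters of
    [w] may repeat, so the vector may vanish. *)
Definition polytabloid w : 'rV[F]_#|{: word}| :=
  \sum_(p in R) \sum_(q in C) (-1) ^+ q *: word_vec (wact w (p * q)).

Lemma polytabloid_col w q :
  q \in C -> polytabloid (wact w q) = (-1) ^+ q *: polytabloid w.
Proof.
move=> qC; rewrite /polytabloid scaler_sumr; apply: eq_bigr => p _.
rewrite scaler_sumr [RHS](reindex_inj (mulIg q)) /=.
apply: eq_big => [t|t _]; first by rewrite groupMr.
by rewrite wactM mulgA scalerA odd_permM signr_addb mulrCA -signr_addb addbb mulr1.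
Qed.

(** The transposition of [x] and [y] fixes [w] but negates its polytabloid, and 2 is invertible. *)
Lemma polytabloid_tperm_eq w x y :
  x \in K -> y \in K -> x != y -> col x = col y -> w x = w y -> polytabloid w = 0.
Proof.
move=> xK yK xy cxy wxy.
have tC : tperm x y \in C by apply: fibre_stab_tperm.
have := polytabloid_col w tC; rewrite wact_tperm // odd_tperm xy scaleN1r.
by move/eqP; rewrite -subr_eq0 opprK -mulr2n -scaler_nat scaler_eq0 pnatr_eq0 => /eqP.
Qed.

(* Pairing each [k] with [t * k], where the transposition [t] of [S] becomes
   a row permutation once conjugated by [q]. *)
Lemma polytabloid_garnir (S : {set T}) w :
    S \subset K ->
    (forall q, q \in C -> exists x y, [/\ x \in S, y \in S, x != y &
       row (q x) = row (q y)]) ->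
  \sum_(k in Sym S) (-1) ^+ k *: polytabloid (wact w k) = 0.
Proof.
move=> SK coll.
transitivity (\sum_(q in C) (-1) ^+ q *: \sum_(k in Sym S) \sum_(p in R)
    (-1) ^+ k *: word_vec (wact w (p * q * k))).
  under eq_bigr => k _ do rewrite /polytabloid exchange_big scaler_sumr.
  rewrite exchange_big; apply: eq_bigr => q _ /=.
  rewrite scaler_sumr; apply: eq_bigr => k _.
  rewrite !scaler_sumr; apply: eq_bigr => p _.
  by rewrite wactM !scalerA mulrC.
apply: big1 => q qC; apply/eqP; rewrite scaler_eq0; apply/orP; right.
set A := \sum_(k in _) _.
have [x [y [xS yS xy rxy]]] := coll _ (groupVr qC).
pose t := tperm x y.
have tS : t \in Sym S by apply: Sym_tperm.
have [qK _] := fibre_stabP _ _ _ (groupVr qC).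
have tR : (t ^ q^-1)%g \in R.
  rewrite tpermJ; apply: fibre_stab_tperm => //;
  by rewrite Sym_stable // (subsetP SK).
suff : A = - A.
  by move/eqP; rewrite -subr_eq0 opprK -mulr2n -scaler_nat scaler_eq0 pnatr_eq0.
rewrite {1}/A (reindex_inj (mulgI t)) -sumrN /=.
apply: eq_big => [k|k _]; first by rewrite groupMl.
rewrite (reindex_inj (mulIg (t ^ q^-1)%g)) -sumrN /=.
apply: eq_big => [p|p _]; first by rewrite groupMr.
rewrite odd_permM odd_tperm xy signrN scaleNr; congr (- (_ *: word_vec (wact w _))).
by rewrite /conjg invgK !mulgA mulgKV -(mulgA _ t t) tperm2 mulg1.
Qed.

End Polytabloid.

(** * Straightening and triangularity *)

Section Straightening.

Variables (F : numFieldType) (T : finType) (N : nat) (K : {set T}).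
Variables (row col : T -> nat).
(** The shape enters only through these two properties: [K] is a set of distinct cells, closed under
    moving up and left. *)
Hypothesis cell_inj :
  forall x y, x \in K -> y \in K -> row x = row y -> col x = col y -> x = y.
Hypothesis cell_down : forall x r c, x \in K -> (r <= row x)%N ->
  (c <= col x)%N -> exists y, [/\ y \in K, row y = r & col y = c].
Local Notation word := {ffun T -> 'I_N}.
Implicit Types (v w : word).
Local Notation R := (fibre_stab K row).
Local Notation C := (fibre_stab K col).
Local Notation polytabloid := (polytabloid F K row col).

Definition row_weak w := [forall x in K, forall y in K,
  (row x == row y) && (col x < col y)%N ==> (w x <= w y)%N].
Definition col_strict w := [forall x in K, forall y in K,
  (col x == col y) && (row x < row y)%N ==> (w x < w y)%N].
Definition ssyt w := row_weak w && col_strict w.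

Lemma row_weakP w : reflect
  (forall x y, x \in K -> y \in K -> row x = row y -> (col x < col y)%N ->
     (w x <= w y)%N) (row_weak w).
Proof.
apply: (iffP forall_inP) => [h x y xK yK e l|h x xK].
  by move/forall_inP: (h x xK) => /(_ y yK)/implyP; apply; rewrite e eqxx.
by apply/forall_inP=> y yK; apply/implyP=> /andP[/eqP e l]; apply: h.
Qed.

Lemma col_strictP w : reflect
  (forall x y, x \in K -> y \in K -> col x = col y -> (row x < row y)%N ->
     (w x < w y)%N) (col_strict w).
Proof.
apply: (iffP forall_inP) => [h x y xK yK e l|h x xK].
  by move/forall_inP: (h x xK) => /(_ y yK)/implyP; apply; rewrite e eqxx.
by apply/forall_inP=> y yK; apply/implyP=> /andP[/eqP e l]; apply: h.
Qed.

(** Sorting is done by maximising the row weight over [C]: a remaining descent in a column could be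
    swapped, which would raise the weight. *)
Lemma col_sort w : exists2 q, q \in C &
  (forall q', q' \in C -> weight row (wact w q') <= weight row (wact w q)) /\
  (forall x y, x \in K -> y \in K -> col x = col y -> (row x < row y)%N ->
     (wact w q x <= wact w q y)%N).
Proof.
have [q qC qmax] := @arg_maxP _ _ _ 1%g (fun q => q \in C)
  (fun q => weight row (wact w q)) (group1 _).
exists q => //; split; first exact: qmax.
move=> x y xK yK cxy rxy; rewrite leqNgt; apply/negP=> lt.
have tC : tperm x y \in C by apply: fibre_stab_tperm.
have := weight_tperm rxy lt; rewrite wactM ltNge => /negP; apply.
by apply: qmax; exact: groupM.
Qed.

(** Induction down a column gives [row x <= row (q x)]; both sides have the same sum over all [x],
    so equality holds everywhere. *)
Lemma col_increasing_id q :
  q \in C ->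
  (forall x y, x \in K -> y \in K -> col x = col y -> (row x < row y)%N ->
     (row (q x) < row (q y))%N) ->
  q = 1%g.
Proof.
move=> qC qinc; have [qK qc] := fibre_stabP _ _ _ qC.
have le r : forall x, x \in K -> row x = r -> (r <= row (q x))%N.
  elim: r => // r IH x xK rx.
  have [||y [yK ry cy]] := @cell_down x r (col x) xK; rewrite ?rx //.
  by apply: leq_ltn_trans (IH _ yK ry) _; apply: qinc; rewrite ?ry ?rx.
have le' x : (row x <= row (q x))%N.
  have [xK|xK] := boolP (x \in K); first exact: le.
  by rewrite (Sym_out qK xK).
have eqr x : row (q x) = row x.
  have [_] := @leqif_sum _ xpredT (fun x => row x == row (q x)) row (fun x => row (q x))
    (fun x _ => conj (le' x) erefl).
  rewrite [X in X == _](reindex_inj (@perm_inj _ q)) eqxx => /esym/forallP/(_ x).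
  by move/eqP.
apply/permP=> x; rewrite perm1.
have [xK|xK] := boolP (x \in K); last by rewrite (Sym_out qK xK).
by apply: cell_inj; rewrite ?Sym_stable.
Qed.

(** A maximiser of the row weight has weakly increasing columns. As the columns of [w] are strict,
    such a [q] must preserve the order in each column, hence is the identity. *)
Lemma weight_col_strict w q :
    col_strict w -> q \in C ->
  weight row (wact w q) <= weight row w ?= iff (q == 1%g).
Proof.
move=> ws; have strict q' : q' \in C ->
    (forall x y, x \in K -> y \in K -> col x = col y -> (row x < row y)%N ->
      (wact w q' x <= wact w q' y)%N) -> q' = 1%g.
  move=> qC inc; have [qK qc] := fibre_stabP _ _ _ qC.
  apply: col_increasing_id => // x y xK yK cxy rxy.
  have := inc x y xK yK cxy rxy; rewrite !ffunE => le.
  case: ltngtP => // [lt|e].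
    by move/col_strictP: ws => /(_ (q' y) (q' x)); rewrite !Sym_stable // !qc;
      move=> /(_ yK xK (esym cxy) lt); rewrite ltnNge le.
  have exy : x = y.
    by apply: (@perm_inj _ q'); apply: cell_inj; rewrite ?Sym_stable // !qc.
  by rewrite exy ltnn in rxy.
have [q0 q0C [q0max q0inc]] := col_sort w.
have q01 := strict _ q0C q0inc; rewrite q01 wact1 in q0max.
move=> qC; split; first exact: q0max.
apply/eqP/eqP => [e|->]; last by rewrite wact1.
apply: strict => // x y xK yK cxy rxy; rewrite leqNgt; apply/negP=> lt.
have tC : tperm x y \in C by apply: fibre_stab_tperm.
have := weight_tperm rxy lt; rewrite wactM e ltNge => /negP; apply.
by apply: q0max; exact: groupM.
Qed.

(** A weakly increasing row is determined by its multiset of letters, recorded here by the numbers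
    [#|L v r t|] of entries at most [t]. *)
Lemma row_weak_uniq w p :
  p \in R -> row_weak w -> row_weak (wact w p) -> {in K, wact w p =1 w}.
Proof.
move=> pR /row_weakP ww /row_weakP wp; have [pK pr] := fibre_stabP _ _ _ pR.
pose L (v : word) r (t : nat) := [set y in K | (row y == r) && (v y <= t)%N].
have cardL r t : #|L (wact w p) r t| = #|L w r t|.
  rewrite -(card_imset (L _ r t) (@perm_inj _ p)); apply: eq_card => y.
  have [z ->] : exists z, y = p z by exists (p^-1 y)%g; rewrite permKV.
  rewrite mem_imset; last exact: perm_inj.
  by rewrite [in LHS]in_set [in RHS]in_set ffunE pr Sym_stable.
(* If [v x < v' x] then row [row x] has fewer entries at most [v x] in [v']. *)
have key (v v' : word) x : row_weak v -> row_weak v' -> x \in K ->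
    (forall r t, #|L v r t| = #|L v' r t|) -> (v' x <= v x)%N.
  move=> /row_weakP vw /row_weakP vw' xK cL; rewrite leqNgt; apply/negP=> lt.
  have sub : L v' (row x) (v x) \proper L v (row x) (v x).
    apply/properP; split; last first.
      by exists x; rewrite !inE xK eqxx ?leqnn //= -ltnNge.
    apply/subsetP=> y; rewrite !inE => /and3P[yK /eqP ry le]; rewrite yK ry eqxx /=.
    case: (ltngtP (col y) (col x)) => [lc|lc|e].
    - exact: vw.
    - by have := vw' x y xK yK (esym ry) lc; rewrite leqNgt (leq_ltn_trans le lt).
    - by rewrite (cell_inj yK xK).
  by have := proper_card sub; rewrite cL ltnn.
move=> x xK; apply/val_inj/eqP; rewrite eqn_leq.
have [/row_weakP ww' /row_weakP wp'] := (ww, wp).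
by rewrite !key // => r t; rewrite cardL.
Qed.

Lemma polytabloidE w u : polytabloid w 0 (enum_rank u) =
  \sum_(p in R) \sum_(q in C) (-1) ^+ q * (wact w (p * q) == u)%:R.
Proof.
rewrite summxE; apply: eq_bigr => p _; rewrite summxE; apply: eq_bigr => q _.
by rewrite !mxE eqxx (inj_eq enum_rank_inj) eq_sym.
Qed.

(** [p] keeps every letter in its row, so only [q] can change the row weight. *)
Lemma polytabloid_supp w u p q : ssyt w -> p \in R -> q \in C ->
  wact w (p * q) = u -> weight row u <= weight row w ?= iff (q == 1%g).
Proof.
move=> /andP[_ ws] pR qC <-; rewrite -wactM (@weight_stab _ _ row (wact w q)).
  exact: weight_col_strict.
by case/fibre_stabP: pR.
Qed.

(** If the weight does not drop then [q = 1], and [u] is a rearrangement of [w] within rows; both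
    having weakly increasing rows, they coincide. *)
Lemma polytabloid_triangular w u : ssyt w -> ssyt u ->
  polytabloid w 0 (enum_rank u) != 0 -> u = w \/ weight row u < weight row w.
Proof.
move=> ws us; rewrite polytabloidE => nz.
have [p pR] : exists2 p, p \in R &
    \sum_(q in C) (-1) ^+ q * (wact w (p * q) == u)%:R != 0 :> F.
  apply/exists_inP; apply: contraNT nz => /exists_inPn h.
  by apply/eqP/big1 => p /h/negPn/eqP.
move=> nzp; have [q qC] : exists2 q, q \in C &
    (-1) ^+ q * (wact w (p * q) == u)%:R != 0 :> F.
  apply/exists_inP; apply: contraNT nzp => /exists_inPn h.
  by apply/eqP/big1 => q /h/negPn/eqP.
have [e _|_] := eqVneq (wact w (p * q)%g) u; last by rewrite /= mulr0n mulr0 eqxx.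
have := polytabloid_supp ws pR qC e => /leifP.
have [q1 _|_ lt] := eqVneq q 1%g; [left|by right].
apply/ffunP=> x; rewrite -e q1 mulg1.
have [xK|xK] := boolP (x \in K).
  apply: row_weak_uniq => //; first by case/andP: ws.
  by rewrite -[p]mulg1 -q1 e; case/andP: us.
by have [pK _] := fibre_stabP _ _ _ pR; rewrite ffunE (Sym_out pK xK).
Qed.

(** Only [q = 1] contributes, so the coefficient counts the row permutations fixing [w]; it is
    positive because of the identity. *)
Lemma polytabloid_diag w : ssyt w -> polytabloid w 0 (enum_rank w) != 0.
Proof.
move=> ws; rewrite polytabloidE.
rewrite (eq_bigr (fun p => (wact w p == w)%:R)) => [|p pR].
  rewrite (bigD1 1%g) ?group1 //= wact1 eqxx gt_eqF // ltr_wpDr ?ltr01 //.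
  by apply: sumr_ge0 => p _; exact: ler0n.
rewrite (bigD1 1%g) ?group1 //= odd_perm1 expr0 mul1r mulg1.
rewrite big1 ?addr0 // => q /andP[qC q1].
have [e|_] := eqVneq (wact w (p * q)%g) w; last by rewrite /= mulr0n mulr0.
by have [_] := polytabloid_supp ws pR qC e; rewrite eqxx (negbTE q1).
Qed.

Lemma polytabloid_free (S : {set word}) : {in S, forall w, ssyt w} ->
  \rank (\matrix_(i < #|S|) polytabloid (enum_val i)) = #|S|.
Proof.
move=> Sstd; apply/eqP; rewrite -/(row_free _) -kermx_eq0; apply/rowV0P=> a.
move/sub_kermxP/rowP=> a0; apply/rowP=> i; rewrite mxE; apply/eqP.
apply/negPn/negP=> ai.
(* Among the words in the linear relation, one of largest row weight occurs in no other polytabloid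
   of the relation. *)
have [j aj jmax] := @arg_maxP _ _ _ i (fun i => a 0 i != 0)
   (fun i => weight row (enum_val i)) ai.
have jS := enum_valP j.
have := a0 (enum_rank (enum_val j)); rewrite !mxE (bigD1 j) //= big1 => [|k kj].
  apply/eqP; rewrite addr0 mulf_neq0 // mxE polytabloid_diag //; exact: Sstd.
apply/eqP; rewrite mulf_eq0; apply/norP=> -[ak]; rewrite mxE.
case/polytabloid_triangular; [exact/Sstd/enum_valP|exact: Sstd| |].
  by move/enum_val_inj=> e; rewrite e eqxx in kj.
by rewrite ltNge => /negP; apply; apply: jmax.
Qed.

(* At a descent [x0], [y0] of a row these cells outnumber the rows of the column
   of [x0]; the two columns need not be adjacent. *)
Definition garnir_set x0 y0 : {set T} :=
  [set z in K | (col z == col x0) && (row x0 <= row z)%N] :|: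
  [set z in K | (col z == col y0) && (row z <= row y0)%N].

(** Pigeonhole: [q] preserves columns, and moving left shows that every row met by the image of [S]
    already meets the column of [x0], which has fewer rows than [S] has cells. *)
Lemma garnir_collision x0 y0 q :
    x0 \in K -> y0 \in K -> row x0 = row y0 -> (col x0 < col y0)%N -> q \in C ->
  exists x y, [/\ x \in garnir_set x0 y0, y \in garnir_set x0 y0, x != y &
    row (q x) = row (q y)].
Proof.
move=> x0K y0K r0 c0 qC; have [qK qc] := fibre_stabP _ _ _ qC.
set S := garnir_set x0 y0.
(* Rows are read in a finite type so that sets of rows have cardinalities. *)
pose ro z : 'I_(\max_z row z).+1 := inord (row z).
have roE z z' : ro z = ro z' -> row z = row z'.
  by move/(congr1 val); rewrite /= !inordK // ltnS leq_bigmax.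
have roq : ro @: (q @: S) \subset [set ro z | z in [set z in K | col z == col x0]].
  apply/subsetP=> _ /imsetP[_ /imsetP[z zS ->] ->].
  have [zK cz] : z \in K /\ (col x0 <= col z)%N.
    by move: zS; rewrite !inE => /orP[] /and3P[zK /eqP-> _] //; split=> //; exact: ltnW.
  have [|||y [yK ry cy]] := @cell_down (q z) (row (q z)) (col x0);
    rewrite ?Sym_stable ?qc //.
  by apply/imsetP; exists y; rewrite ?inE ?yK ?cy //= /ro ry.
have lt : (#|ro @: (q @: S)| < #|S|)%N.
  apply: leq_ltn_trans (subset_leq_card roq) _.
  rewrite /S /garnir_set; set X := [set z in K | _ && (row x0 <= _)%N].
  set Y := [set z in K | _ && (_ <= row y0)%N].
  have dXY : [disjoint X & Y].
    rewrite -setI_eq0; apply/eqP/setP=> z; rewrite !inE; apply/negP.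
    by move=> /andP[/and3P[_ /eqP cz _] /and3P[_ /eqP cz' _]]; rewrite -cz cz' ltnn in c0.
  have injX (A : {set T}) c : {in A, forall y, y \in K /\ col y = c} -> #|ro @: A| = #|A|.
    move=> hA; apply: card_in_imset => y z /hA[yK cy] /hA[zK cz] /roE e.
    by apply: cell_inj; rewrite ?cz.
  have [_] := leq_card_setU X Y; rewrite dXY => /eqP->.
  rewrite -(injX X (col x0)); last by move=> z; rewrite inE => /and3P[? /eqP].
  rewrite -(injX Y (col y0)); last by move=> z; rewrite inE => /and3P[? /eqP].
  (* The rows of the two pieces together cover those of the column of [x0], and the row of [x0] is
     counted twice: this is the extra cell. *)
  rewrite -cardsUI -addn1 leq_add //.
    apply: subset_leq_card; apply/subsetP=> _ /imsetP[z + ->].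
    rewrite inE => /andP[zK /eqP cz].
    rewrite inE; case: (leqP (row x0) (row z)) => rz.
      by rewrite imset_f // inE zK cz eqxx.
    have [||y [yK ry cy]] := @cell_down y0 (row z) (col y0) y0K;
      rewrite // -?r0 ?(ltnW rz) //.
    apply/orP; right; apply/imsetP; exists y; last by rewrite /ro ry.
    by rewrite inE yK cy eqxx ry -r0 ltnW.
  rewrite card_gt0; apply/set0Pn; exists (ro x0); rewrite inE; apply/andP; split.
    by apply: imset_f; rewrite inE x0K eqxx /=.
  have -> : ro x0 = ro y0 by rewrite /ro r0.
  by apply: imset_f; rewrite inE y0K eqxx /=.
have : ~~ dinjectiveb (ro \o q) S.
  apply: contraL lt => /dinjectiveP inj; rewrite -leqNgt -imset_comp.
  by rewrite card_in_imset.
case/dinjectivePn=> x xS [y] /andP[yx yS] /= /roE e; exists x, y.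
by split=> //; rewrite eq_sym.
Qed.

(** Strict columns make all letters of the left piece exceed [w y0], and all those of the right
    piece at most [w y0]. With this threshold, a permutation that changes columns can only move
    large letters right and small ones left. *)
Lemma garnir_weight w x0 y0 k : col_strict w ->
    x0 \in K -> y0 \in K -> row x0 = row y0 -> (col x0 < col y0)%N ->
    (w y0 < w x0)%N -> k \in Sym (garnir_set x0 y0) -> k \notin C ->
  weight col w < weight col (wact w k).
Proof.
move=> /col_strictP ws x0K y0K r0 c0 lt kS kC.
have SK z : z \in garnir_set x0 y0 -> z \in K by rewrite !inE => /orP[]/andP[].
have kK : k \in Sym K.
  by move: kS; rewrite !inE => /subsetP kS; apply/subsetP=> z /kS/SK.
have hiS z : z \in garnir_set x0 y0 ->
   (col z == col x0) && (w y0 < w z)%N || (col z == col y0) && (w z <= w y0)%N.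
  rewrite !inE => /orP[] /and3P[zK /eqP cz rz]; rewrite cz eqxx /=; apply/orP.
    left; move: rz; rewrite leq_eqVlt => /orP[/eqP rz|rz].
      by rewrite -(cell_inj x0K zK).
    by apply: ltn_trans lt _; apply: ws.
  right; move: rz; rewrite leq_eqVlt => /orP[/eqP rz|rz].
    by rewrite (cell_inj zK y0K).
  by apply: ltnW; apply: ws.
have colS z : z \in garnir_set x0 y0 -> col z = col x0 \/ col z = col y0.
  by move/hiS=> /orP[]/andP[/eqP-> _]; [left|right].
have [z0 z0c] : exists z, col (k z) != col z.
  apply/existsP; apply: contraNT kC; rewrite negb_exists => /forallP h.
  by apply/fibre_stabP; split=> // z; apply/eqP/negPn/h.
apply: (@weight_rearrange _ _ _ _ _ (w y0) z0) => // z lw.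
  have [zS|zS] := boolP (z \in garnir_set x0 y0); last by rewrite (Sym_out kS zS).
  have /hiS : k z \in garnir_set x0 y0 by rewrite Sym_stable.
  rewrite lw leqNgt lw andbF orbF andbT => /eqP->.
  by case: (colS z zS) => ->; rewrite // ltnW.
have [zS|zS] := boolP (z \in garnir_set x0 y0); last by rewrite (Sym_out kS zS).
have /hiS : k z \in garnir_set x0 y0 by rewrite Sym_stable.
rewrite ltnNge lw andbF andbT => /eqP->.
by case: (colS z zS) => ->; rewrite // ltnW.
Qed.

(** Induction on the number of words of larger column weight. Columns are sorted first, at the cost
    of a sign and without changing that weight; a repeated letter in a column gives zero, and a row
    descent gives a Garnir relation. *)
Lemma straightening m (Y : 'M[F]_(m, #|{: word}|)) v :
    (forall g, g \in Sym K -> ssyt (wact v g) -> (polytabloid (wact v g) <= Y)%MS) ->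
  (polytabloid v <= Y)%MS.
Proof.
pose above v := [set v' : word | weight col v < weight col v'].
have [b] := ubnP #|above v|; elim: b => // b IH in v * => le stdY.
have [q qC [_ qinc]] := col_sort v; have [qK qc] := fibre_stabP _ _ _ qC.
set u := wact v q in qinc *.
have uv : polytabloid v = (-1) ^+ q *: polytabloid u.
  by rewrite polytabloid_col // scalerA -signr_addb addbb scale1r.
rewrite uv; apply: scalemx_sub.
have stdu g : g \in Sym K -> ssyt (wact u g) -> (polytabloid (wact u g) <= Y)%MS.
  by move=> gK; rewrite wactM; apply: stdY; rewrite groupM.
have [/exists_inP[x xK /exists_inP[y yK /and3P[cxy rxy /eqP uxy]]]|/exists_inPn nocoll] :=
    boolP [exists x in K, exists y in K,
             [&& col x == col y, (row x < row y)%N & u x == u y]].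
  rewrite (@polytabloid_tperm_eq _ _ _ _ row col u x y xK yK _ (eqP cxy) uxy) ?sub0mx //.
  by apply: contraTneq rxy => ->; rewrite ltnn.
have us : col_strict u.
  apply/col_strictP=> x y xK yK cxy rxy; rewrite ltn_neqAle qinc // andbT.
  apply: contra (nocoll x xK) => uxy; apply/exists_inP; exists y => //.
  by rewrite cxy eqxx rxy; apply/eqP/val_inj/eqP.
have [uw|] := boolP (row_weak u).
  by rewrite -[u]wact1; apply: stdu; rewrite ?group1 // wact1 /ssyt uw us.
case/forall_inPn=> x0 x0K /forall_inPn[y0 y0K].
rewrite negb_imply -ltnNge => /andP[/andP[/eqP r0 c0] lt].
set S := garnir_set x0 y0.
have SK : S \subset K by apply/subsetP=> z; rewrite !inE => /orP[]/andP[].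
have SymSK k : k \in Sym S -> k \in Sym K.
  by rewrite !inE => /subset_trans; apply.
have := @polytabloid_garnir F _ _ _ row col _ u SK
  (fun q qC => garnir_collision x0K y0K r0 c0 qC).
(* Each [k] in [C] contributes [polytabloid u] itself, its sign occurring twice. A nonzero multiple
   of [polytabloid u] is thus a combination of polytabloids of words of larger column weight. *)
rewrite (bigID (fun k => k \in C)) /=.
rewrite (eq_bigr (fun=> polytabloid u)) => [|k /andP[_ kC]]; last first.
  by rewrite polytabloid_col // scalerA -signr_addb addbb scale1r.
rewrite sumr_const -scaler_nat => /eqP; rewrite addr_eq0 => /eqP e.
have n0 : #|[pred k in Sym S | k \in C]|%:R != 0 :> F.
  rewrite pnatr_eq0 -lt0n; apply/card_gt0P; exists 1%g.
  by apply/andP; split; exact: group1.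
rewrite -[polytabloid u](scalerK n0) scalemx_sub // e -scaleN1r scalemx_sub //.
apply: summx_sub => k /andP[kS kC]; apply/scalemx_sub/IH.
  rewrite -ltnS; apply: leq_trans le; rewrite ltnS; apply: proper_card.
  have ltk := garnir_weight us x0K y0K r0 c0 lt kS kC.
  have vu : weight col v = weight col u by rewrite weight_stab.
  apply/properP; split; last by exists (wact u k); rewrite !inE ?ltxx // vu.
  by apply/subsetP=> w; rewrite !inE vu; apply: lt_trans.
by move=> g gK; rewrite wactM; apply: stdu; apply: groupM gK (SymSK _ kS).
Qed.

End Straightening.

(** * Young's rule *)

(** In a rank factorisation of [M], idempotence makes the product of the factors in reverse order
    the identity of size the rank. *)
Lemma mxtrace_idempotent (F : fieldType) r (M : 'M[F]_r) :
  M *m M = M -> \tr M = (\rank M)%:R.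
Proof.
move=> MM.
have BC : row_base M *m col_base M = 1%:M.
  apply: (row_full_inj (col_base_full M)); apply: (row_free_inj (row_base_free M)).
  by rewrite mulmx1 mulmxA -[LHS]mulmxA !mulmx_base.
by rewrite -{1}(mulmx_base M) mxtrace_mulC BC mxtrace1.
Qed.

(** Divided by the order of [H], the sum is the projector onto the [H]-invariants. *)
Lemma mxtrace_repr_sum (F : numFieldType) (gT : finGroupType) (G H : {group gT})
    r (rG : mx_representation F G r) :
  H \subset G ->
  \sum_(h in H) \tr (rG h) = (#|H| * \rank (\sum_(h in H) rG h)%R)%:R.
Proof.
move=> sHG; set M := (X in \rank X).
have -> : \sum_(h in H) \tr (rG h) = \tr M.
  by rewrite /M raddf_sum.
have H0 : #|H|%:R != 0 :> F by rewrite pnatr_eq0 -lt0n cardG_gt0.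
have MM : M *m M = #|H|%:R *: M.
  rewrite mulmx_suml (eq_bigr (fun=> M)) ?sumr_const ?scaler_nat // => h hH.
  rewrite mulmx_sumr [RHS](reindex_inj (mulgI h)) /=.
  by apply: eq_big => [k|k kH]; rewrite ?groupMl // repr_mxM ?(subsetP sHG).
have := @mxtrace_idempotent _ _ (#|H|%:R^-1 *: M).
rewrite -scalemxAl -scalemxAr MM scalerK // => /(_ erefl).
have -> : \rank (#|H|%:R^-1 *: M) = \rank M by rewrite eqmx_scale ?invr_eq0.
rewrite mxtraceZ natrM => e; apply: (mulfI (invr_neq0 H0)).
by rewrite mulKf.
Qed.

Lemma cyclic_mx_rows (F : fieldType) (gT : finGroupType) (G : {group gT}) r
    (rG : mx_representation F G r) (u : 'rV_r) :
  (cyclic_mx rG u :=: \matrix_(i < #|G|) (u *m rG (enum_val i)))%MS.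
Proof.
apply: eqmx_trans (genmxE _) _.
suff -> : (enveloping_algebra_mx rG *m lin_mul_row u)%R =
   \matrix_(i < #|G|) (u *m rG (enum_val i)) by [].
by apply/row_matrixP=> i; rewrite row_mul !rowK mul_vec_lin_row.
Qed.

Section SpechtTrace.

Variables (F : numFieldType) (N n : nat) (K : {set 'I_n}) (lam : seq nat).
Hypothesis cell_inj : forall x y, x \in K -> y \in K ->
  tab_row lam K x = tab_row lam K y -> tab_col lam K x = tab_col lam K y -> x = y.
Hypothesis cell_down : forall x r c, x \in K -> (r <= tab_row lam K x)%N ->
  (c <= tab_col lam K x)%N ->
  exists y, [/\ y \in K, tab_row lam K y = r & tab_col lam K y = c].
Local Notation word := {ffun 'I_n -> 'I_N}.
Local Notation ssyt := (ssyt K (tab_row lam K) (tab_col lam K)).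
Local Notation polytabloid := (polytabloid F K (tab_row lam K) (tab_col lam K)).
Local Notation G := (Sym_group K).
Local Notation rG := (regular_repr F G).
Local Notation c := (young_symmetrizer F lam K).

Variable w : word.

(** The matrix of the map from the group algebra onto the span of the rearrangements of [w]. *)
Definition orbit_mx : 'M[F]_(#|G|, #|{: word}|) :=
  \matrix_(i < #|G|) word_vec F (wact w (enum_val i)).

Lemma gring_orbit g : g \in G ->
  delta_mx 0 (gring_index G g) *m orbit_mx = word_vec F (wact w g).
Proof. by move=> gG; rewrite -rowE rowK gring_indexK. Qed.

Lemma young_orbit g : g \in G ->
  c *m rG g *m orbit_mx = polytabloid (wact w g).
Proof.
move=> gG; rewrite /young_symmetrizer !mulmx_suml; apply: eq_bigr => p pR.
rewrite !mulmx_suml; apply: eq_bigr => q qC.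
have [pK _] := fibre_stabP _ _ _ pR; have [qK _] := fibre_stabP _ _ _ qC.
rewrite -!scalemxAl -rowE rowK gring_indexK ?groupM // gring_orbit ?groupM //.
by rewrite wactM.
Qed.

Definition word_stab : {set 'S_n} := [set h in Sym K | wact w h == w].

Lemma word_stab_group_set : group_set word_stab.
Proof.
apply/group_setP; rewrite in_set group1 wact1 eqxx; split=> // s t.
rewrite ![_ \in word_stab]in_set => /andP[sK /eqP sw] /andP[tK /eqP tw].
by rewrite groupM //= -wactM tw sw.
Qed.
Canonical word_stab_group := Group word_stab_group_set.

Local Notation E := (\sum_(h in word_stab) rG h).

(** On both sides the entry at [g], [g'] is 1 exactly when [g^-1 * g'] fixes [w]. With the next
    lemma, [E] and [orbit_mx] each factor through the other, hence have equal rank on any row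
    space. *)
Lemma word_stab_sum : E = orbit_mx *m orbit_mx^T.
Proof.
apply/matrixP=> i j; rewrite summxE !mxE.
pose v := wact w (enum_val i).
rewrite (bigD1 (enum_rank v)) //= [X in _ + X]big1 ?addr0 => [|k kv]; last first.
  by rewrite !mxE eqxx /= (negbTE kv) mul0r.
rewrite !mxE !eqxx /= mul1r (inj_eq enum_rank_inj).
have iG := enum_valP i; have jG := enum_valP j.
set gi := enum_val i in iG v *; set gj := enum_val j in jG *.
pose h0 := (gi^-1 * gj)%g.
have h0E : (h0 \in word_stab) = (v == wact w gj).
  rewrite in_set groupM ?groupV //= -(inj_eq (can_inj (wactK gi))).
  by rewrite wactM mulKVg eq_sym.
rewrite -h0E big_mkcond (bigD1 h0) //= big1 ?addr0 => [|h hh].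
  case: ifP => // _; rewrite !mxE !eqxx /= /h0 mulKVg -/gj.
  by rewrite /gj gring_valK eqxx.
case: ifP => // hS; rewrite !mxE /=.
suff -> : (j == gring_index G (gi * h)) = false by [].
apply: contraNF hh => /eqP e; rewrite /h0 /gj e gring_indexK ?mulKg //.
by rewrite groupM //; move: hS; rewrite in_set => /andP[].
Qed.

Lemma word_stab_sum_orbit : E *m orbit_mx = #|word_stab|%:R *: orbit_mx.
Proof.
apply/row_matrixP=> i; rewrite row_mul linearZ /= rowK linear_sum mulmx_suml /=.
rewrite scaler_nat -sumr_const; apply: eq_bigr => h.
rewrite in_set => /andP[hK /eqP hw].
by rewrite rowK gring_orbit ?groupM ?enum_valP // -wactM hw.
Qed.

Definition orbit_ssyt := [set v in [set wact w g | g in Sym K] | ssyt v].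

(** The image of the Specht module is spanned by the polytabloids of all rearrangements of [w];
    straightening reduces these to the semistandard ones, which are independent. *)
Lemma rank_young_orbit :
  \rank (cyclic_mx rG c *m orbit_mx) = #|orbit_ssyt|.
Proof.
have inK (g : 'S_n) : g \in Sym K -> wact w g \in [set wact w g | g in Sym K].
  exact: imset_f.
rewrite -(@polytabloid_free F _ N _ _ _ cell_inj cell_down orbit_ssyt); last first.
  by move=> v; rewrite in_set => /andP[].
rewrite (eqmxMr _ (cyclic_mx_rows _ _)).
apply/eqmx_rank/andP; split; apply/row_subP=> i.
  rewrite row_mul rowK young_orbit ?enum_valP //.
  apply: (straightening cell_inj cell_down) => g gK ss; rewrite wactM.
  have vS : wact w (g * enum_val i)%g \in orbit_ssyt.
    by rewrite in_set inK ?groupM ?enum_valP //= -wactM.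
  by rewrite -[wact _ _](enum_rankK_in vS vS); apply: eq_row_sub (rowK _ _).
rewrite rowK; have := enum_valP i; rewrite in_set => /andP[/imsetP[g gK ->] _].
rewrite -young_orbit // -{1}[g](@gring_indexK _ G) //.
by apply: (eq_row_sub (gring_index G g)); rewrite row_mul rowK.
Qed.

(** Young's rule, multiplied by the order of the stabiliser: the left side is that order times the
    dimension of the invariants, and each semistandard rearrangement arises from one coset of the
    stabiliser. *)
Lemma specht_char_word_stab :
  \sum_(h in Sym K | wact w h == w) specht_char F lam K h =
    #|[set g in Sym K | ssyt (wact w g)]|%:R.
Proof.
set U := cyclic_mx rG c.
transitivity ((#|word_stab| * #|orbit_ssyt|)%:R : F).
  have sHG : word_stab \subset Sym K by apply/subsetP=> h; rewrite in_set => /andP[].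
  transitivity (\sum_(h in word_stab) \tr (specht_repr F lam K h)).
    by apply: eq_bigl => h; rewrite [in RHS]in_set.
  rewrite (@mxtrace_repr_sum _ _ _ word_stab_group _ (specht_repr F lam K) sHG).
  congr ((_ * _)%:R); rewrite -rank_young_orbit.
  have -> : \sum_(h in word_stab) specht_repr F lam K h =
            in_submod U (val_submod 1%:M *m E) by rewrite mulmx_sumr linear_sum.
  have modU : mxmodule rG U by apply: cyclic_mx_module.
  rewrite mxrank_in_submod; last first.
    rewrite mulmx_sumr; apply: summx_sub => h hS.
    apply: mxmodule_trans modU (subsetP sHG _ hS) _; exact: val_submodP.
  rewrite -(eqmxMr _ (val_submod1 U)); apply/eqP; rewrite eqn_leq.
  rewrite {1}word_stab_sum mulmxA mxrankM_maxl /=.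
  have H0 : #|word_stab|%:R != 0 :> F by rewrite pnatr_eq0 -lt0n cardG_gt0.
  rewrite -[X in (\rank (_ *m X) <= _)%N](scalerK H0) -word_stab_sum_orbit.
  by rewrite -scalemxAr eqmx_scale ?invr_eq0 // mulmxA mxrankM_maxl.
congr (_%:R); rewrite -[RHS]sum1_card (partition_big (wact w) (mem orbit_ssyt)) /=.
  rewrite mulnC -sum_nat_const; apply: eq_bigr => v.
  rewrite in_set => /andP[/imsetP[g gK ->] ss].
  rewrite sum1_card -(card_lcoset _ g); apply: eq_card => k.
  rewrite mem_lcoset [in LHS]in_set [in RHS]unfold_in [k \in [set _ in _ | _]]in_set.
  rewrite groupMl ?groupV //=.
  rewrite -(inj_eq (can_inj (wactK g))) wactM mulKVg -andbA; congr (_ && _).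
  by case: eqP => [->|_]; rewrite ?ss ?andbF.
move=> g; rewrite in_set => /andP[gK ss].
by rewrite in_set ss andbT; apply: imset_f.
Qed.

End SpechtTrace.

(** * Frobenius' formula *)

Section TableauCells.

Variables (n : nat) (lam : seq nat) (K : {set 'I_n}).
Hypothesis (hlam : is_part lam) (hK : #|K| = sumn lam).
Local Notation row := (tab_row lam K).
Local Notation col := (tab_col lam K).

Let ltK x : x \in K -> (index x (enum K) < sumn lam)%N.
Proof. by rewrite -hK cardE index_mem mem_enum. Qed.

Lemma tab_row_lt x : x \in K -> (row x < size lam)%N.
Proof. by move/ltK/reshape_indexP. Qed.

Lemma tab_col_lt x : x \in K -> (col x < nth 0 lam (row x))%N.
Proof. by move/ltK/reshape_offsetP. Qed.

Lemma tab_cell_inj x y :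
  x \in K -> y \in K -> row x = row y -> col x = col y -> x = y.
Proof.
move=> xK yK er ec; rewrite -[x](@nth_index _ x x (enum K)) ?mem_enum //.
have -> : index x (enum K) = index y (enum K).
  rewrite -[LHS](reshape_indexK lam) -/(row x) -/(col x) er ec.
  exact: reshape_indexK.
by rewrite nth_index ?mem_enum.
Qed.

Lemma tab_cell_ex r c : (c < nth 0 lam r)%N ->
  exists y, [/\ y \in K, row y = r & col y = c].
Proof.
move=> lt; have ltf := flatten_indexP lt; have := ltf; rewrite -hK cardE.
(* The bound on the flat index makes [enum K] nonempty; [y0] serves only as a default for [nth]. *)
case e : (enum K) => [//|y0 s]; rewrite -e => lt'.
exists (nth y0 (enum K) (flatten_index lam r c)).
rewrite /tab_row /tab_col index_uniq ?enum_uniq // flatten_indexKl // flatten_indexKr //.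
by rewrite -mem_enum mem_nth.
Qed.

Lemma tab_cell_down x r c : x \in K -> (r <= row x)%N -> (c <= col x)%N ->
  exists y, [/\ y \in K, row y = r & col y = c].
Proof.
move=> xK ler lec; apply: tab_cell_ex; apply: leq_ltn_trans lec _.
apply: leq_trans (tab_col_lt xK) _.
have /andP[sl _] := hlam.
have geq_trans : transitive geq by move=> a b d /[swap]; apply: leq_trans.
by apply: (sorted_leq_nth geq_trans leqnn 0 sl) => //; rewrite inE ?tab_row_lt //;
  apply: leq_ltn_trans (tab_row_lt xK).
Qed.

End TableauCells.

Section Frobenius.

Variables (F : numFieldType) (N n : nat) (lam : seq nat) (K : {set 'I_n}).
Variable i0 : 'I_N.
Hypothesis (hlam : is_part lam) (hK : #|K| = sumn lam).
Local Notation word := {ffun 'I_n -> 'I_N}.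
Local Notation row := (tab_row lam K).
Local Notation col := (tab_col lam K).
Local Notation ssyt := (ssyt K row col).

(** Words on [K] are encoded as words on all of ['I_n] with the constant letter [i0] off [K]. *)
Definition word_on (w : word) := [forall k, (k \notin K) ==> (w k == i0)].

Lemma word_onP (w : word) : reflect (forall k, k \notin K -> w k = i0) (word_on w).
Proof.
by apply: (iffP forallP) => h k; [move=> kK; have := h k; rewrite kK => /eqP |
  apply/implyP=> /h/eqP].
Qed.

Lemma word_on_act (w : word) s : s \in Sym K -> word_on (wact w s) = word_on w.
Proof.
have imp (v : word) t : t \in Sym K -> word_on v -> word_on (wact v t).
  by move=> tK /word_onP vi; apply/word_onP=> k kK; rewrite ffunE (Sym_out tK) ?vi.
move=> sK; apply/idP/idP; last exact: imp.
by move/(imp _ s^-1%g); rewrite wactK; apply; rewrite groupV.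
Qed.

Lemma schur_words (x : 'I_N -> F) :
  schur lam x = \sum_(w | word_on w && ssyt w) \prod_(k in K) x (w k).
Proof.
have [pos posP] : exists pos : cell lam -> 'I_n, forall c,
    [/\ pos c \in K, row (pos c) = cell_row c & col (pos c) = cell_col c].
  apply: (@fin_all_exists _ (fun=> 'I_n) (fun c k =>
    [/\ k \in K, row k = cell_row c & col k = cell_col c])) => c.
  by apply: tab_cell_ex => //; apply: ltn_ord.
have pos_inj : injective pos.
  move=> c d e; have [_ rc cc] := posP c; have [_ rd cd] := posP d.
  move: rc cc; rewrite e rd cd; case: c d {e rd cd} => [i j] [i' j'].
  rewrite /cell_row /cell_col /= => /val_inj ei; case: _ / ei in j * => /val_inj ej.
  by rewrite ej.
have posK k : k \in K -> exists c, k = pos c.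
  move=> kK.
  pose c : cell lam := Tagged (fun i : 'I_(size lam) => 'I_(nth 0%N lam i))
    (Ordinal (tab_col_lt hK kK) : 'I_(nth 0%N lam (Ordinal (tab_row_lt hK kK)))).
  exists c; have [pK r_ c_] := posP c.
  by apply: (tab_cell_inj kK pK); [exact: esym r_ | exact: esym c_].
pose fill (t : {ffun cell lam -> 'I_N}) : word :=
  [ffun k => if [pick c | pos c == k] is Some c then t c else i0].
have fillE t c : fill t (pos c) = t c.
  by rewrite ffunE; case: pickP => [d /eqP/pos_inj->|/(_ c)/eqP].
rewrite (reindex_onto fill (fun w => [ffun c => w (pos c)])) /=; last first.
  move=> w /andP[/word_onP wi _]; apply/ffunP=> k.
  have [/posK[c ->]|kK] := boolP (k \in K); first by rewrite fillE ffunE.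
  rewrite wi // ffunE; case: pickP => // c /eqP ck.
  by case: (posP c); rewrite ck (negbTE kK).
apply: eq_big => [t|t _]; last first.
  have -> : \prod_(k in K) x (fill t k) =
            \prod_(k in pos @: [set: cell lam]) x (fill t k).
    apply: eq_bigl => k; apply/idP/imsetP => [/posK[c ->]|[c _ ->]]; first by exists c.
    by case: (posP c).
  rewrite big_imset /=; last by move=> c d _ _; apply: pos_inj.
  by apply: eq_big => [c|c _]; rewrite ?inE ?fillE.
have -> : [ffun c => fill t (pos c)] == t.
  by apply/eqP/ffunP=> c; rewrite ffunE fillE.
have -> : word_on (fill t).
  apply/word_onP=> k kK; rewrite ffunE; case: pickP => // c /eqP ck.
  by case: (posP c); rewrite ck (negbTE kK).
rewrite andbT /=; apply/forallP/andP => [h|[/row_weakP hr /col_strictP hc] c].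
  split.
    apply/row_weakP=> _ _ /posK[c ->] /posK[d ->]; rewrite !fillE.
    have [_ -> ->] := posP c; have [_ -> ->] := posP d => e lt.
    by have /forallP/(_ d)/andP[/implyP + _] := h c; apply; rewrite e eqxx.
  apply/col_strictP=> _ _ /posK[c ->] /posK[d ->]; rewrite !fillE.
  have [_ -> ->] := posP c; have [_ -> ->] := posP d => e lt.
  by have /forallP/(_ d)/andP[_ /implyP] := h c; apply; rewrite e eqxx.
apply/forallP=> d; have [cK rc cc] := posP c; have [dK rd cd] := posP d.
rewrite -rc -cc -rd -cd -!(fillE t).
by apply/andP; split; apply/implyP=> /andP[/eqP e lt]; [apply: hr|apply: hc].
Qed.

(** Both sides count pairs of a word [w] and an [s] with [wact w s] semistandard, weighted by the
    monomial of [w]. For fixed [s] this gives the Schur polynomial; for fixed [w], Young's rule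
    gives the character sum over the stabiliser. *)
Lemma frobenius_formula (x : 'I_N -> F) :
  (sumn lam)`!%:R * schur lam x =
  \sum_(s in Sym K) specht_char F lam K s *
    \sum_(w | word_on w && (wact w s == w)) \prod_(k in K) x (w k).
Proof.
transitivity (\sum_(w | word_on w) (\prod_(k in K) x (w k)) *
   \sum_(s in Sym K | wact w s == w) specht_char F lam K s); last first.
  under [RHS]eq_bigr => s _ do rewrite mulr_sumr big_mkcondr.
  rewrite [RHS]exchange_big; apply: eq_bigr => w _ /=.
  rewrite mulr_sumr big_mkcondr; apply: eq_bigr => s _.
  by case: ifP => // _; exact: mulrC.
transitivity (\sum_(w | word_on w) \sum_(s in Sym K)
    (\prod_(k in K) x (w k)) *+ (ssyt (wact w s))).
  rewrite exchange_big /= -hK -(card_Sym K) mulr_natl -sumr_const.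
  apply: eq_bigr => s sK; rewrite (schur_words x) (reindex_inj (can_inj (wactK s))) /=.
  rewrite [RHS]big_mkcond [LHS]big_mkcond; apply: eq_bigr => w _.
  rewrite word_on_act //; case: (word_on w); case: (ssyt _) => //=; rewrite mulr1n.
  rewrite [RHS](reindex_inj (@perm_inj _ s)) /=.
  by apply: eq_big => [k|k _]; rewrite ?Sym_stable ?ffunE.
apply: eq_bigr => w _; rewrite specht_char_word_stab.
- rewrite -sum1_card natr_sum mulr_sumr big_mkcond [RHS]big_mkcond.
  apply: eq_bigr => s _; rewrite in_set; case: (s \in _) => //=.
  by case: (ssyt _); rewrite ?mulr1.
- exact: tab_cell_inj.
- exact: tab_cell_down.
Qed.

End Frobenius.

(** * From eigenvalues to matrices *)

Section TensorTrace.

Variables (C : comNzRingType) (n N : nat).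
Local Notation word := {ffun 'I_n -> 'I_N}.
Implicit Types (A P Q : 'I_n -> 'M[C]_N) (s : 'S_n).

(* The trace of [A 0 (x) ... (x) A n.-1] composed with a tensor permutation. *)
Definition tensor_trace A s : C := \sum_(w : word) \prod_k A k (w (s k)) (w k).

(** Cyclicity of the trace; carrying [Q] past the tensor permutation shifts its index by [s]. *)
Lemma tensor_trace_mulC P Q s :
  tensor_trace (fun k => P k *m Q k) s = tensor_trace (fun k => Q (s k) *m P k) s.
Proof.
transitivity (\sum_(w : word) \sum_(v : word)
    (\prod_k P k (w (s k)) (v k)) * (\prod_k Q k (v k) (w k))).
  apply: eq_bigr => w _; under eq_bigr => k _ do rewrite mxE.
  by rewrite bigA_distr_bigA; apply: eq_bigr => v _; rewrite big_split.
rewrite exchange_big; apply: eq_bigr => v _ /=.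
rewrite [RHS](reindex_inj (@perm_inj _ s^-1)) /=.
under [RHS]eq_bigr => k _ do rewrite permKV mxE.
rewrite bigA_distr_bigA; apply: eq_bigr => w _; rewrite big_split mulrC /=; congr (_ * _).
rewrite [LHS](reindex_inj (@perm_inj _ s^-1)) /=.
by apply: eq_bigr => k _; rewrite permKV.
Qed.

Lemma tensor_trace_conj A P Q s :
    (forall k, P (s k) = P k) -> (forall k, A (s k) = A k) ->
    (forall k, Q (s k) = Q k) -> (forall k, Q k *m P k = 1%:M) ->
  tensor_trace (fun k => P k *m A k *m Q k) s = tensor_trace A s.
Proof.
move=> sP sA sQ QP; transitivity (tensor_trace (fun k => P k *m (A k *m Q k)) s).
  by apply: eq_bigr => w _; apply: eq_bigr => k _; rewrite mulmxA.
rewrite tensor_trace_mulC; apply: eq_bigr => w _; apply: eq_bigr => k _.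
by rewrite sA sQ -mulmxA QP mulmx1.
Qed.

End TensorTrace.

(** A nonzero product needs [w k <= w (s k)] for all [k]; summing over [k] forces equalities. *)
Lemma tensor_trace_trig (C : numDomainType) n N (A : 'I_n -> 'M[C]_N) (s : 'S_n) :
    (forall k, is_trig_mx (A k)) ->
  tensor_trace A s = \sum_(w | wact w s == w) \prod_k A k (w k) (w k).
Proof.
move=> trA; rewrite big_mkcond; apply: eq_bigr => w _; case: eqP => [ws|ws].
  by apply: eq_bigr => k _; congr (A k _ _); rewrite -{2}ws ffunE.
apply/eqP/prodf_eq0; apply/exists_inP; apply: contra_notT ws => /exists_inPn h.
have le k : (w k <= w (s k))%N.
  rewrite leqNgt; apply/negP=> lt.
  by have := h k isT; rewrite (is_trig_mxP (trA k)) // eqxx.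
have [_] := @leqif_sum _ xpredT (fun k => w k == w (s k) :> nat)
  (fun k => w k : nat) (fun k => w (s k) : nat)
  (fun k _ => conj (le k) erefl).
rewrite [X in X == _](reindex_inj (@perm_inj _ s)) eqxx => /esym/forallP e.
by apply/ffunP=> k; rewrite ffunE; apply/val_inj/esym/eqP/(e k).
Qed.

Section SchurMatrix.

Variables (C : numClosedFieldType) (N n : nat) (lam : seq nat) (K : {set 'I_n}).
Variable i0 : 'I_N.
Hypothesis (hlam : is_part lam) (hK : #|K| = sumn lam).
Local Notation word := {ffun 'I_n -> 'I_N}.

Lemma char_poly_conj (h P Q : 'M[C]_N) :
  Q *m P = 1%:M -> char_poly (P *m h *m Q) = char_poly h.
Proof.
move=> QP; have PQ := mulmx1C QP.
have -> : char_poly (P *m h *m Q) =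
   \det (map_mx polyC P *m char_poly_mx h *m map_mx polyC Q).
  congr (\det _); rewrite /char_poly_mx mulmxBr mulmxBl !map_mxM /=; congr (_ - _).
  by rewrite scalar_mxC -mulmxA -map_mxM PQ map_mx1 mulmx1.
by rewrite !det_mulmx mulrAC -det_mulmx -map_mxM PQ map_mx1 det1 mul1r.
Qed.

Lemma eigenvalues_trig (h P Q : 'M[C]_N) : Q *m P = 1%:M ->
    is_trig_mx (P *m h *m Q) ->
  exists s : 'S_N, forall i : 'I_N, (eigenvalues h)`_i = (P *m h *m Q) (s i) (s i).
Proof.
move=> QP tr; set t := P *m h *m Q in tr *.
have ph : \prod_(z <- eigenvalues h) ('X - z%:P) =
          \prod_(z <- [tuple t i i | i < N]) ('X - z%:P).
  transitivity (char_poly h).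
    rewrite /eigenvalues; case: closed_field_poly_normal => r /= e.
    by rewrite e (monicP (char_poly_monic h)) scale1r.
  rewrite -(char_poly_conj h QP) (char_poly_trig tr) big_map big_enum //.
have /tuple_permP[s es] := prod_XsubC_eq ph.
exists s => i; rewrite es (nth_map i) ?size_enum_ord // nth_ord_enum.
by rewrite tnth_mktuple.
Qed.

(** The rank-one matrix off [K] forces the letter [i0] there, cutting the trace down to words on
    [K]. *)
Definition word_mx (h : 'M[C]_N) (k : 'I_n) : 'M[C]_N :=
  if k \in K then h else delta_mx i0 i0.

Lemma frobenius_formula_mx (h : 'M[C]_N) :
  (sumn lam)`!%:R * schur_mx lam h =
  \sum_(s in Sym K) specht_char C lam K s * tensor_trace (word_mx h) s.
Proof.
have [P Pu tr] : trigonalizable_in (@unitarymx C N N) h.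
  by apply: Schur; apply: leq_ltn_trans (ltn_ord i0).
rewrite /similar_to /= conjumx ?unitarymx_unit // in tr.
have QP : invmx P *m P = 1%:M by rewrite mulVmx ?unitarymx_unit.
have [p ep] := eigenvalues_trig QP tr.
set t := P *m h *m invmx P in tr ep.
rewrite (frobenius_formula i0 hlam hK); apply: eq_bigr => s sK; congr (_ * _).
have sm (X Y : 'M[C]_N) k : (if s k \in K then X else Y) = (if k \in K then X else Y).
  by rewrite Sym_stable.
transitivity (tensor_trace (word_mx t) s); last first.
  rewrite -(@tensor_trace_conj _ _ _ (word_mx h) (fun k => if k \in K then P else 1%:M)
    (fun k => if k \in K then invmx P else 1%:M)) //.
  - apply: eq_bigr => w _; apply: eq_bigr => k _; rewrite /word_mx.
    by case: (k \in K); rewrite // mulmx1 mul1mx.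
  - by move=> k; rewrite /word_mx sm.
  - by move=> k; case: (k \in K); rewrite // mulmx1.
rewrite tensor_trace_trig; last first.
  move=> k; rewrite /word_mx; case: ifP => // _; apply/is_trig_mxP => i j lt.
  by rewrite mxE; case: eqP => //= ei; case: eqP => //= ej; rewrite ei ej ltnn in lt.
(* The eigenvalues and the diagonal of [t] agree only up to the permutation [p]; relabelling the
   letters on [K] by [p] absorbs it. *)
pose twist (q : 'S_N) (w : word) : word := [ffun k => if k \in K then q (w k) else w k].
have twistK q : cancel (twist q) (twist q^-1%g).
  by move=> w; apply/ffunP=> k; rewrite /twist !ffunE; case: (k \in K); rewrite ?permK.
have twist_on q w : word_on K i0 (twist q w) = word_on K i0 w.
  apply: eq_forallb => k; rewrite ffunE; by case: (k \in K).
have twist_fix w : (wact (twist p w) s == twist p w) = (wact w s == w).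
  rewrite -[RHS](inj_eq (can_inj (twistK p))); congr (_ == _); apply/ffunP=> k.
  by rewrite /twist !ffunE Sym_stable.
transitivity (\sum_(w | word_on K i0 w && (wact w s == w)) \prod_(k in K) t (w k) (w k)).
  rewrite [RHS](reindex_inj (can_inj (twistK p))) /=.
  apply: eq_big => [w|w _]; first by rewrite twist_on twist_fix.
  by apply: eq_bigr => k kK; rewrite ffunE kK ep.
rewrite (bigID (word_on K i0) (fun w => _ == w)) /=.
rewrite [X in _ + X]big1 ?addr0 => [|w /andP[_ wi]].
  apply: eq_big => [w|w /andP[/word_onP wi _]]; first by rewrite andbC.
  rewrite [RHS](bigID (mem K)) /= [X in _ * X]big1 ?mulr1 => [|k kK].
    by apply: eq_bigr => k kK; rewrite /word_mx kK.
  by rewrite /word_mx (negbTE kK) wi // mxE eqxx.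
move/forallPn: wi => [k]; rewrite negb_imply => /andP[kK wk].
by rewrite (bigD1 k) //= /word_mx (negbTE kK) mxE (negbTE wk) mul0r.
Qed.

End SchurMatrix.

(** * Mixed partial derivatives *)

Lemma is_derive_horner (C : numFieldType) (p : {poly C}) (x : C) :
  is_derive x 1 (horner p : C -> C^o) (p^`().[x]).
Proof.
elim/poly_ind: p => [|p c IH].
  have -> : horner (0 : {poly C}) = cst 0 by apply/funext=> y; rewrite horner0.
  by rewrite deriv0 horner0; apply: is_derive_cst.
have -> : (horner (p * 'X + c%:P) : C -> C^o) = (horner p : C -> C^o) * id + cst c.
  by apply/funext=> y; rewrite /= !hornerE.
apply: is_derive_eq.
rewrite addr0 derivD derivC addr0 derivM derivX mulr1 hornerD hornerMX.
by rewrite addrC mulrC; congr (_ + _); exact: mulr1.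
Qed.

Section MixedPartial.

Variables (C : numClosedFieldType) (I : finType).
Implicit Types (e : I -> C).

Lemma partial_horner k (g : (I -> C) -> C) e (p : {poly C}) :
  (forall t, g [eta e with k |-> t] = p.[t]) -> partial k g e = p^`().[e k].
Proof.
move=> gp; rewrite /partial (_ : (fun t => _) = (horner p : C -> C^o)); last exact/funext.
by rewrite derive1E; exact: (@derive_val _ _ _ _ _ _ _ (is_derive_horner p (e k))).
Qed.

(** Truncated subtraction is harmless: at exponent 0 the new coefficient vanishes. *)
Lemma partial_sum_monomials (X : finType) (P : pred X) (c : X -> C)
    (al : X -> I -> nat) k :
  partial k (fun e => \sum_(x | P x) c x * \prod_i e i ^+ al x i) =
  fun e => \sum_(x | P x) (c x * (al x k)%:R) * \prod_i e i ^+ (al x i - (i == k)).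
Proof.
apply/funext=> e.
pose rest x := \prod_(i | i != k) e i ^+ al x i.
rewrite (@partial_horner _ _ _ (\sum_(x | P x) (c x * rest x) *: 'X^(al x k)));
  last first.
  move=> t; rewrite horner_sum; apply: eq_bigr => x _.
  rewrite hornerZ hornerXn (bigD1 k) //= eqxx [RHS]mulrAC -[RHS]mulrA.
  congr (_ * (_ * _)).
  by apply: eq_bigr => i /negbTE ik; rewrite ik.
rewrite linear_sum horner_sum; apply: eq_bigr => x _.
rewrite /= derivZ derivXn hornerZ hornerMn hornerXn (bigD1 k) //= eqxx subn1.
rewrite (eq_bigr (fun i => e i ^+ al x i)) -/(rest x) => [|i /negbTE ik]; last first.
  by rewrite ik subn0.
by rewrite -mulr_natr; ring.
Qed.

Lemma foldr_partial_sum_monomials (X : finType) (P : pred X) (c : X -> C)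
    (al : X -> I -> nat) (r : seq I) : uniq r ->
  foldr (@partial C I) (fun e => \sum_(x | P x) c x * \prod_i e i ^+ al x i) r =
  fun e => \sum_(x | P x) (c x * \prod_(k <- r) (al x k)%:R) *
             \prod_i e i ^+ (al x i - (i \in r)).
Proof.
elim: r => [_|k r IH] /=.
  apply/funext=> e; apply: eq_bigr => x _; rewrite big_nil mulr1.
  by congr (_ * _); apply: eq_bigr => i _; rewrite subn0.
move=> /andP[kr ur]; rewrite IH // partial_sum_monomials; apply/funext=> e.
apply: eq_bigr => x _; rewrite big_cons (negbTE kr) subn0; congr (_ * _).
  by rewrite -mulrA [X in _ * X]mulrC.
apply: eq_bigr => i _; rewrite in_cons -subnDA; congr (_ ^+ (_ - _)).
by case: eqVneq => [->|]; rewrite ?(negbTE kr) ?addn0.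
Qed.

(** An exponent 0 is killed by differentiation, an exponent at least 2 by evaluation at 0. *)
Lemma mixed_partial_sum_monomials (X : finType) (P : pred X) (c : X -> C)
    (al : X -> I -> nat) :
  mixed_partial0 (fun e => \sum_(x | P x) c x * \prod_i e i ^+ al x i) =
  \sum_(x | P x && [forall i, al x i == 1%N]) c x.
Proof.
rewrite /mixed_partial0 foldr_partial_sum_monomials ?enum_uniq // big_mkcondr.
apply: eq_bigr => x _; rewrite big_enum -mulrA -big_split /=.
case: forallP => [al1|/forallP/forallPn[i al1]].
  by rewrite big1 ?mulr1 // => i _; rewrite (eqP (al1 i)) mem_enum subnn mul1r.
rewrite (bigD1 i) //= mem_enum.
case: (al x i) al1 => [|[|a]] // _; first by rewrite mul0r mul0r mulr0.
by rewrite subSS subn0 exprS !(mul0r, mulr0).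
Qed.

(** Expanding the product over choice functions [f], the exponent of [e i] is the size of the fibre
    of [f] at [i], so exactly the bijections survive. *)
Lemma mixed_partial_prod (X D : finType) (P : pred X) (c : X -> C)
    (M : X -> D -> I -> C) :
  mixed_partial0 (fun e => \sum_(x | P x) c x * \prod_d \sum_l e l * M x d l) =
  \sum_(x | P x) c x *
    \sum_(f : {ffun D -> I} | [forall i, #|[set d | f d == i]| == 1%N])
      \prod_d M x d (f d).
Proof.
transitivity (mixed_partial0 (fun e => \sum_(xf : X * {ffun D -> I} | P xf.1)
    (c xf.1 * \prod_d M xf.1 d (xf.2 d)) * \prod_i e i ^+ #|[set d | xf.2 d == i]|)).
  congr mixed_partial0; apply/funext=> e.
  rewrite (eq_bigl (fun xf => P xf.1 && xpredT xf.2)) => [|xf]; last by rewrite andbT.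
  rewrite -(pair_big P xpredT (fun x (f : {ffun D -> I}) => (c x * \prod_d M x d (f d)) *
     \prod_i e i ^+ #|[set d | f d == i]|)) /=.
  apply: eq_bigr => x _; rewrite bigA_distr_bigA mulr_sumr; apply: eq_bigr => f _.
  rewrite big_split -mulrA; congr (_ * _); rewrite mulrC; congr (_ * _).
  rewrite (partition_big f xpredT) //=; apply: eq_bigr => i _.
  rewrite -prodr_const; apply: eq_big => [d|d /eqP->//]; by rewrite inE.
rewrite mixed_partial_sum_monomials.
rewrite -(pair_big_dep P
   (fun _ (f : {ffun D -> I}) => [forall i, #|[set d | f d == i]| == 1%N])
   (fun x f => c x * \prod_d M x d (f d))) /=.
by apply: eq_bigr => x _; rewrite mulr_sumr.
Qed.

End MixedPartial.

(** * Polarisation *)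

Section FactorOperators.

Variables (R : comNzRingType) (N n : nat) (I : eqType) (v : I -> 'I_n).
Hypothesis v_inj : injective v.
Variable A : I -> 'M[R]_N.

Lemma prod_factor_op (r : seq I) : uniq r ->
  \prod_(k <- r) factor_op (v k) (A k) =
  op_of (fun a b => (\prod_(k <- r) A k (a (v k)) (b (v k))) *+
           [forall l, (l \notin map v r) ==> (a l == b l)]).
Proof.
elim: r => [_|k r IH /andP[kr ur]].
  rewrite big_nil; apply/matrixP=> i j; rewrite !mxE big_nil -(inj_eq enum_val_inj).
  congr (_ *+ _); congr nat_of_bool; apply/eqP/forallP => [-> l|h].
    by rewrite eqxx implybT.
  by apply/ffunP=> l; apply/eqP; have := h l.
rewrite big_cons IH //; apply/matrixP=> i j; rewrite [LHS]mxE !mxE big_cons.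
set a := enum_val i; set b := enum_val j.
(* The only intermediate multi-index that contributes to the matrix product. *)
pose c : mindex N n := [ffun l => if l == v k then b l else a l].
rewrite (bigD1 (enum_rank c)) //= [X in _ + X]big1 ?addr0 => [|h hc].
  rewrite !mxE enum_rankK -/a -/b.
  have -> : [forall l, (l != v k) ==> (a l == c l)].
    by apply/forallP=> l; rewrite ffunE; case: eqVneq => //=; rewrite eqxx.
  rewrite mulr1n ffunE eqxx mulrnAr; congr (_ * _ *+ nat_of_bool _).
    apply: eq_big_seq => l lr; rewrite ffunE (inj_eq v_inj).
    by case: eqVneq => // lk; rewrite -lk lr in kr.
  apply: eq_forallb => l; rewrite ffunE in_cons negb_or.
  by case: (eqVneq l (v k)) => [->|_] /=; rewrite ?eqxx ?implybT.
rewrite !mxE -/a -/b; case: forallP => [ac|]; last by rewrite mul0r.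
case: forallP => [cb|]; last by rewrite mulr0.
case/eqP: hc; rewrite -[h]enum_valK; congr enum_rank.
apply/ffunP=> l; rewrite ffunE; case: eqVneq => [->|lk].
  apply/eqP; have := cb (v k); rewrite mem_map //; by move/implyP; apply.
by apply/esym/eqP; have := ac l; rewrite lk.
Qed.

End FactorOperators.

Section MixedDerivativeOperator.

Variables (C : numClosedFieldType) (N : nat) (lam : seq nat) (i0 : 'I_N).
Hypothesis hlam : is_part lam.

Lemma tensor_trace_word_mx n (K : {set 'I_n}) (h : 'M[C]_N) (s : 'S_n) : s \in Sym K ->
  tensor_trace (word_mx K i0 h) s =
  \sum_(w : {ffun 'I_n -> 'I_N} | word_on K i0 w)
    \prod_(d : {k | k \in K}) h (w (s (val d))) (w (val d)).
Proof.
move=> sK; rewrite [RHS]big_mkcond; apply: eq_bigr => w _.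
case: ifP => [/word_onP wi|/negbT].
  rewrite (bigID (mem K)) /= [X in _ * X]big1 ?mulr1 => [|k kK].
    rewrite -(big_sub (mem K) (fun k => h (w (s k)) (w k))).
    by apply: eq_bigr => k kK; rewrite /word_mx kK.
  by rewrite /word_mx (negbTE kK) (Sym_out sK kK) wi // mxE eqxx.
case/forallPn=> k; rewrite negb_imply => /andP[kK wk].
by rewrite (bigD1 k) //= /word_mx (negbTE kK) mxE (negbTE wk) andbF mul0r.
Qed.

Lemma schur_mx_words n (K : {set 'I_n}) (h : 'M[C]_N) : #|K| = sumn lam ->
  schur_mx lam h =
  \sum_(x : 'S_n * {ffun 'I_n -> 'I_N} | (x.1 \in Sym K) && word_on K i0 x.2)
    ((sumn lam)`!%:R^-1 * specht_char C lam K x.1) *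
    \prod_(d : {k | k \in K}) h (x.2 (x.1 (val d))) (x.2 (val d)).
Proof.
move=> hK; have m0 : (sumn lam)`!%:R != 0 :> C by rewrite pnatr_eq0 -lt0n fact_gt0.
apply: (mulfI m0); rewrite (frobenius_formula_mx i0 hlam hK).
rewrite -(pair_big (mem (Sym K)) (word_on K i0) (fun s (w : {ffun 'I_n -> 'I_N}) =>
  ((sumn lam)`!%:R^-1 * specht_char C lam K s) *
    \prod_(d : {k | k \in K}) h (w (s (val d))) (w (val d)))) /=.
rewrite mulr_sumr; apply: eq_bigr => s sK.
by rewrite tensor_trace_word_mx // -mulr_sumr -[in RHS]mulrA mulVKf.
Qed.

Lemma mixed_partial_schur n (K : {set 'I_n}) (I : finType) (p : I -> 'I_N * 'I_N) :
  #|K| = sumn lam ->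
  mixed_partial0 (fun e =>
    schur_mx lam (0 + \sum_k e k *: delta_mx (p k).2 (p k).1) : C) =
  \sum_(x : 'S_n * {ffun 'I_n -> 'I_N} | (x.1 \in Sym K) && word_on K i0 x.2)
    ((sumn lam)`!%:R^-1 * specht_char C lam K x.1) *
    \sum_(f : {ffun {k | k \in K} -> I} | [forall i, #|[set d | f d == i]| == 1%N])
      \prod_d ((x.2 (x.1 (val d)) == (p (f d)).2) && (x.2 (val d) == (p (f d)).1))%:R.
Proof.
move=> hK; rewrite -(mixed_partial_prod _ _
   (fun (x : 'S_n * {ffun 'I_n -> 'I_N}) (d : {k | k \in K}) l =>
   ((x.2 (x.1 (val d)) == (p l).2) && (x.2 (val d) == (p l).1))%:R)).
congr mixed_partial0; apply/funext=> e; rewrite (schur_mx_words _ hK).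
apply: eq_bigr => x _; congr (_ * _); apply: eq_bigr => d _.
by rewrite add0r summxE; apply: eq_bigr => l _; rewrite !mxE.
Qed.

(** Homogeneity of degree [sumn lam]. Since [K] has the wrong size, the Schur function is expanded
    over the model set of all of ['I_(sumn lam)]; a surviving [f] would be a bijection from it to
    [K]. *)
Lemma dop_schur_eq0 n (K : {set 'I_n}) : #|K| != sumn lam ->
  dop K (@schur_mx C lam N) 0 = 0.
Proof.
move=> hK; apply: big1 => p _; 
rewrite (@mixed_partial_schur (sumn lam) [set: 'I_(sumn lam)]) ?cardsT ?card_ord //.
rewrite big1 ?scale0r // => x _; rewrite big1 ?mulr0 // => f /forallP f1.
case/eqP: hK.
have -> : sumn lam = #|{: {k : 'I_(sumn lam) | k \in [set: 'I_(sumn lam)]}}|.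
  by rewrite card_sig cardsT card_ord.
rewrite -(card_sig (mem K)) -[LHS]sum1_card -[RHS]sum1_card.
rewrite [RHS](partition_big f xpredT) //=.
apply: eq_bigr => i _; rewrite sum1_card; apply/esym/eqP; rewrite -(eqP (f1 i)).
by apply/eqP/eq_card=> d; rewrite !inE.
Qed.

End MixedDerivativeOperator.

Lemma specht_char_conj (F : fieldType) n lam (K : {set 'I_n}) (s g : 'S_n) :
  s \in Sym K -> g \in Sym K -> specht_char F lam K (s ^ g)%g = specht_char F lam K s.
Proof.
move=> sK gK; rewrite /specht_char /conjg !repr_mxM ?groupV ?groupM //.
by rewrite mxtrace_mulC -mulmxA -repr_mxM ?groupV // mulgV repr_mx1 mulmx1.
Qed.

Lemma perm_of_sub_inj n (K : {set 'I_n}) (f : {k | k \in K} -> {k | k \in K}) :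
  injective f -> exists2 g : 'S_n, g \in Sym K & forall d, g (val d) = val (f d).
Proof.
move=> f_inj; pose gf x : 'I_n := if insub x is Some d then val (f d) else x.
have gf_inj : injective gf.
  move=> x y; rewrite /gf; case: insubP => [d _ <-|xK]; case: insubP => [d' _ <-|yK] //.
  - by move/val_inj/f_inj->.
  - by move=> e; move: yK; rewrite -e (valP (f d)).
  - by move=> e; move: xK; rewrite e (valP (f d')).
exists (perm gf_inj) => [|d]; last by rewrite permE /gf valK.
rewrite inE; apply/fintype.subsetP=> x; rewrite inE permE /gf.
by case: insubP => // _; rewrite eqxx.
Qed.

Lemma injectiveb_fibres (I : finType) (f : {ffun I -> I}) :
  injectiveb f = [forall i, #|[set d | f d == i]| == 1%N].
Proof.
apply/injectiveP/forallP => [f_inj i|f1 d d' e].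
  rewrite (_ : [set d | f d == i] = [set invF f_inj i]) ?cards1 //.
  by apply/setP=> d; rewrite !inE -{1}(f_invF f_inj i) (inj_eq f_inj).
have /cards1P[x ex] := f1 (f d').
have /set1P-> : d \in [set x] by rewrite -ex inE e.
by have /set1P-> : d' \in [set x] by rewrite -ex inE.
Qed.

Section DopSchur.

Variables (C : numClosedFieldType) (N n : nat) (lam : seq nat) (i0 : 'I_N).
Variable K : {set 'I_n}.
Hypothesis (hlam : is_part lam) (hK : #|K| = sumn lam).
Local Notation word := {ffun 'I_n -> 'I_N}.
Local Notation D := {k : 'I_n | k \in K}.

Lemma dop_schur : dop K (@schur_mx C lam N) 0 = alpha_op C N lam K.
Proof.
apply/matrixP=> i j; rewrite summxE [RHS]summxE.
set a := enum_val i; set b := enum_val j.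
transitivity (\sum_(s in Sym K) specht_char C lam K s * (wact a s == b)%:R); last first.
  apply: eq_bigr => s sK; rewrite !mxE -/a -/b; congr (_ * (nat_of_bool _)%:R).
  apply/eqP/forallP=> [<- l|h]; first by rewrite ffunE permKV.
  by apply/ffunP=> l; have := h (s l); rewrite ffunE permK => /eqP.
pose offK := [forall l, (l \notin K) ==> (a l == b l)].
have prodE (p : {ffun D -> 'I_N * 'I_N}) :
    (\prod_(k : D) factor_op (val k) (delta_mx (p k).1 (p k).2)) i j =
    (\prod_(k : D) ((a (val k), b (val k)) == p k)%:R) *+ offK :> C.
  rewrite (prod_factor_op val_inj) ?index_enum_uniq // mxE -/a -/b.
  congr (_ *+ nat_of_bool _).
    by apply: eq_bigr => k _; rewrite mxE; case: (p k).
  apply: eq_forallb => l; congr (~~ _ ==> _); apply/mapP/idP => [[k _ ->]|lK].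
    exact: valP.
  by exists (Sub l lK); rewrite ?mem_index_enum.
have [offKT|offKF] := boolP offK; last first.
  rewrite [LHS]big1 => [|p _]; last by rewrite mxE prodE (negbTE offKF) mulr0n mulr0.
  rewrite big1 // => s sK; case: eqP => [e|]; last by rewrite mulr0.
  case/forallPn: offKF => l; rewrite negb_imply => /andP[lK].
  by rewrite -e ffunE (Sym_out sK lK) eqxx.
(* The matrix units have a nonzero entry at [a], [b] for this choice of indices alone. *)
pose p0 : {ffun D -> 'I_N * 'I_N} := [ffun k => (a (val k), b (val k))].
rewrite (bigD1 p0) //= [X in _ + X]big1 ?addr0 => [|p pp0]; last first.
  rewrite mxE prodE; have [k kp] : exists k, (a (val k), b (val k)) != p k.
    apply/existsP; apply: contraNT pp0 => /existsPn h; apply/eqP/ffunP=> k.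
    by rewrite ffunE; apply/esym/eqP/negPn/h.
  by rewrite (bigD1 k) //= (negbTE kp) mul0r mul0rn mulr0.
rewrite mxE prodE offKT big1 ?mulr1n ?mulr1 => [|k _]; last by rewrite ffunE eqxx.
rewrite (@mixed_partial_schur C N lam i0 hlam _ K _ p0 hK).
rewrite -(pair_big (mem (Sym K)) (word_on K i0) (fun s (w : word) =>
  ((sumn lam)`!%:R^-1 * specht_char C lam K s) *
    \sum_(f : {ffun D -> D} | [forall d, #|[set d' | f d' == d]| == 1%N])
    \prod_d ((w (s (val d)) == (p0 (f d)).2) && (w (val d) == (p0 (f d)).1))%:R)) /=.
pose target := \sum_(s in Sym K) specht_char C lam K s * (wact a s == b)%:R : C.
(* Each bijection [f] contributes the full entry [target], and the number of bijections cancels the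
   factorial. *)
transitivity ((sumn lam)`!%:R^-1 *
   \sum_(f : {ffun D -> D} | [forall d, #|[set d' | f d' == d]| == 1%N]) target).
  under eq_bigr => s _ do under eq_bigr => w _ do rewrite -mulrA mulr_sumr.
  under eq_bigr => s _ do rewrite -mulr_sumr.
  rewrite -mulr_sumr; congr (_ * _).
  under eq_bigr => s _ do rewrite exchange_big.
  rewrite exchange_big; apply: eq_bigr => f; rewrite -injectiveb_fibres => /injectiveP f_inj /=.
  have [g gK gE] := perm_of_sub_inj f_inj.
  (* [g] extends [f] by the identity; conjugation by it leaves the character unchanged. *)
  rewrite /target [RHS](reindex_inj (@conjg_inj _ g)) /=.
  apply: eq_big => [s|s sK]; first by rewrite groupJr.
  rewrite specht_char_conj // -mulr_sumr; congr (_ * _).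
  (* The first components of [p0] force this word; the second ones then say that [wact a (s ^ g)]
     agrees with [b] on [K]. *)
  pose w0 : word := [ffun k => if k \in K then a (g k) else i0].
  rewrite (bigD1 w0) /=; last by apply/word_onP=> k kK; rewrite ffunE (negbTE kK).
  rewrite [X in _ + X]big1 ?addr0 => [|w /andP[/word_onP wi ww]]; last first.
    have [d wd] : exists d : D, w (val d) != a (g (val d)).
      apply/existsP; apply: contraNT ww => /existsPn h; apply/eqP/ffunP=> k.
      rewrite ffunE; case: ifPn => [kK|/wi//].
      by have := h (Sub k kK) => /negPn/eqP.
    by rewrite (bigD1 d) //= ffunE /= -gE (negbTE wd) andbF mul0r.
  have sgE k : k \in K -> w0 (s k) = wact a (s ^ g) (g k).
    by move=> kK; rewrite !ffunE Sym_stable // kK /conjg !permM permK.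
  case: eqP => [ab|nab].
    apply: big1 => d _; rewrite (sgE _ (valP d)) ab !ffunE (valP d) gE /=.
    by rewrite !eqxx.
  apply/eqP/prodf_eq0/exists_inP; apply: contra_notT nab => /exists_inPn h.
  apply/ffunP=> l; have [lK|lK] := boolP (l \in K); last first.
    rewrite ffunE (Sym_out _ lK) ?groupJ //; apply/eqP.
    by move/forallP: offKT => /(_ l)/implyP; apply.
  have g'K : (g^-1)%g l \in K by rewrite Sym_stable ?groupV.
  pose d : D := exist (fun k => k \in K) _ g'K.
  have := h d isT; rewrite (sgE _ (valP d)) [p0 _]ffunE -gE /= permKV.
  case: (wact a _ l =P b l) => //= _; by rewrite eqxx.
rewrite sumr_const -[target *+ _]mulr_natl.
have cD : #|{: D}| = sumn lam by rewrite card_sig.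
rewrite -(eq_card (fun f => injectiveb_fibres f)) -cardsE card_inj_ffuns cD ffactnn.
by rewrite mulKf // pnatr_eq0 -lt0n fact_gt0.
Qed.

End DopSchur.

Theorem theorem8p2 (R : realType) (N n : nat) (z : 'I_n -> R[i])
    (lam : seq nat) (hN : (0 < N)%N) (hlam : is_part lam) :
  T_op lam z (0 : 'M[R[i]]_N) = beta_op N lam z.
Proof.
rewrite /T_op /beta_op [RHS]big_mkcond; apply: eq_bigr => K _.
case: (boolP (#|K| == sumn lam)) => hK.
  (* [N >= 1] supplies the letter that fills words off [K]. *)
  by rewrite (dop_schur _ (Ordinal hN)) //; apply/eqP.
by rewrite (dop_schur_eq0 _ (Ordinal hN)) // map_mx0 GRing.scaler0.
Qed.
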